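(* A digraph $G$ is weightable if and only if no subdigraph of $G$ is a weak $k$-double-cycle with $k\ge 3$.
   Context: A digraph is a finite directed graph without loops or parallel edges (directed cycles of length two are permitted). A weighting of a digraph $G$ is a map $w:E(G)\to\mathbb{R}$ such that $\sum_{e\in E(C)}w(e)=1$ for every directed cycle $C$ of $G$. $G$ is weightable if it admits a weighting. For $k\ge 3$, a weak $k$-double-cycle is a digraph formed by the union of $k$ directed cycles $C_1,\ldots,C_k$ arranged in circular order, where each vertex belongs to at most two of $C_1,\ldots,C_k$; $C_i\cap C_{i+1}$ is a directed path (non-null, possibly with just one vertex) for $1\le i\le k$ (reading subscripts modulo $k$); and $C_i$ is vertex-disjoint from $C_j$ if $j\ne i-1,i,i+1$ modulo $k$. *)

(* Defs.v *)
From HB Require Import structures.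
From mathcomp Require Import all_boot all_order all_algebra.
From mathcomp Require Import reals.

Set Implicit Arguments.
Unset Strict Implicit.
Unset Printing Implicit Defensive.

Import Order.TTheory GRing.Theory Num.Theory.

(* Digraphs live inside an ambient finite type V, so that a digraph, its
   subdigraphs, and their unions and intersections all have the same type. As
   eset is a set of ordered pairs there are no parallel edges, while (x, y) and
   (y, x) may both be edges. *)
Record digraph (V : finType) : Type := Digraph {
  vset : {set V};
  eset : {set V * V};
  eset_vset : forall x y : V, (x, y) \in eset -> (x \in vset) && (y \in vset);
  eset_loopless : forall x : V, (x, x) \notin eset
}.

Definition subdigraph (V : finType) (H G : digraph V) : Prop :=
  vset H \subset vset G /\ eset H \subset eset G.

Lemma dcap_vset (V : finType) (G H : digraph V) (x y : V) :
  (x, y) \in eset G :&: eset H ->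
  (x \in vset G :&: vset H) && (y \in vset G :&: vset H).
Proof.
by rewrite !inE => /andP[/eset_vset/andP[-> ->] /eset_vset/andP[-> ->]].
Qed.

Lemma dcap_loopless (V : finType) (G H : digraph V) (x : V) :
  (x, x) \notin eset G :&: eset H.
Proof. by rewrite inE (negbTE (eset_loopless G x)). Qed.

Definition dcap (V : finType) (G H : digraph V) : digraph V :=
  Digraph (@dcap_vset V G H) (@dcap_loopless V G H).

(* The vertices of a directed cycle are listed in cyclic order, [next c x] being
   the successor of x; a cycle of length two is allowed. *)
Definition is_dcycle (V : finType) (C : digraph V) : Prop :=
  exists c : seq V,
    [/\ uniq c, 1 < size c, vset C = [set x in c] &
        eset C = [set (x, next c x) | x in c]].

(* [zip (x :: p) p] lists the pairs of consecutive vertices of x :: p. The path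
   is non-null; it is a single vertex when p is empty. *)
Definition is_dpath (V : finType) (P : digraph V) : Prop :=
  exists (x : V) (p : seq V),
    [/\ uniq (x :: p), vset P = [set y in x :: p] &
        eset P = [set e in zip (x :: p) p]].

(* Only the values of w on the edges of G matter. *)
Definition is_weighting (R : realType) (V : finType) (G : digraph V)
    (w : V * V -> R) : Prop :=
  forall C : digraph V, subdigraph C G -> is_dcycle C ->
    (\sum_(e in eset C) w e = 1)%R.

Definition weightable (R : realType) (V : finType) (G : digraph V) : Prop :=
  exists w : V * V -> R, is_weighting G w.

(* The cycles are indexed by 'I_k; [ordS] and [ord_pred] are the cyclic
   successor and predecessor, that is, i + 1 and i - 1 modulo k. *)
Definition weak_double_cycle (V : finType) (k : nat) (H : digraph V) : Prop :=
  exists C : 'I_k -> digraph V,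
    [/\ forall i : 'I_k, is_dcycle (C i),
        vset H = \bigcup_(i < k) vset (C i) /\
        eset H = \bigcup_(i < k) eset (C i),
        forall v : V, #|[set i : 'I_k | v \in vset (C i)]| <= 2,
        forall i : 'I_k, is_dpath (dcap (C i) (C (ordS i))) &
        forall i j : 'I_k, j != ord_pred i -> j != i -> j != ordS i ->
          [disjoint vset (C i) & vset (C j)]].

(* Main.v *)
Require Import Defs.
From HB Require Import structures.
From mathcomp Require Import all_boot all_order all_algebra.
From mathcomp Require Import reals boolp zify.

(** In a weak k-double-cycle let x_i be the first vertex of the path common to
    C_i and C_(i+1). The arcs of the C_i from x_(i-1) to x_i form a directed
    cycle, and so do the arcs from x_i to x_(i-1); together they use every edge
    as often as C_1, ..., C_k do, so a weighting would give 2 = k.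

    Conversely, choose an integral w for which every directed cycle has weight
    at least 1 and every edge of a cycle lies on a cycle of weight 1 (a tight
    cycle). If w is not a weighting, let m be the least weight above 1, and let
    A be a cycle of weight m whose edges are covered by as few arcs as possible,
    each arc being contained in a tight cycle: say k arcs. The remaining parts of
    the k tight cycles lead once around A backwards, which gives a closed walk of
    weight k - m >= 1, so k >= 3. Enlarge the arcs until the remaining part of
    each tight cycle is a path avoiding A. If two of these return
    paths meet, exchanging their ends produces either a tight cycle with a longer
    arc of A or another cycle of weight m, and in both cases fewer arcs suffice.
    Hence the k tight cycles form a weak k-double-cycle. *)

Set Implicit Arguments.
Unset Strict Implicit.
Unset Printing Implicit Defensive.

Import Order.TTheory GRing.Theory Num.Theory.

(** * Closed walks *)

Section WalkLength.
Variables (V : finType) (M : zmodType) (w : V * V -> M).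

Fixpoint wlen (x : V) (p : seq V) : M :=
  if p is y :: q then (w (x, y) + wlen y q)%R else 0%R.

Definition cyclen (c : seq V) : M := if c is x :: p then wlen x (rcons p x) else 0%R.

Lemma wlen_cat x p q : wlen x (p ++ q) = (wlen x p + wlen (last x p) q)%R.
Proof. by elim: p x => [|y p IH] x /=; rewrite ?add0r // IH addrA. Qed.

Lemma wlen_splice x p y q :
  wlen x (p ++ y :: q) = (wlen x (rcons p y) + wlen y q)%R.
Proof. by rewrite -cat_rcons wlen_cat last_rcons. Qed.

Lemma cyclen_cat x p y q :
  cyclen (x :: p ++ y :: q) = (wlen x (rcons p y) + wlen y (rcons q x))%R.
Proof. by rewrite /= rcons_cat /= wlen_splice. Qed.

Lemma cyclen_rot i c : cyclen (rot i c) = cyclen c.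
Proof.
rewrite -{2}(cat_take_drop i c) /rot.
case: (take i c) => [|x p]; first by rewrite cats0.
case: (drop i c) => [|y q]; first by rewrite cats0.
by rewrite !cat_cons !cyclen_cat addrC.
Qed.

(** Distinctness is essential: [next] looks only at the first occurrence of a vertex. *)
Lemma cyclen_next c :
  uniq c -> cyclen c = (\sum_(x <- c) w (x, next c x))%R.
Proof.
case: c => [|x p]; first by rewrite big_nil.
rewrite /= -/(uniq (x :: p)).
(* The closing vertex [y0] is kept apart from the head [y], which moves during the induction. *)
have: forall y0 y, uniq (y :: p) ->
  wlen y (rcons p y0) = (\sum_(z <- y :: p) w (z, next_at z y0 y p))%R.
  elim: p => [|z p IH] y0 y /=; first by rewrite big_seq1 addr0 eqxx.
  case/andP=> Hy Hz; rewrite big_cons eqxx IH //; congr (_ + _)%R.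
  apply: eq_big_seq => t Ht /=; case: eqVneq => // E; by move: Hy; rewrite ?E -?E Ht.
by move=> H U; rewrite (H x x U).
Qed.

End WalkLength.

Definition scycle (V : finType) (e : rel V) (c : seq V) : bool :=
  [&& c != [::], uniq c & cycle e c].

Section Scycle.
Variables (V : finType) (e : rel V).
Hypothesis e_irr : irreflexive e.

Lemma scycle_rot i c : scycle e (rot i c) = scycle e c.
Proof. by rewrite /scycle rot_uniq rot_cycle -!size_eq0 size_rot. Qed.

Lemma scycle_size c : scycle e c -> 1 < size c.
Proof. by case: c => [|x [|y c]] //; rewrite /scycle /= e_irr. Qed.

Lemma not_uniq_split (s : seq V) :
  ~~ uniq s -> exists s1 y s2 s3, s = s1 ++ y :: s2 ++ y :: s3.
Proof.
elim: s => //= x s IH; rewrite negb_and negbK; case/orP.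
  by case/splitPr=> s2 s3; exists [::], x, s2, s3.
by case/IH=> s1 [y [s2 [s3 ->]]]; exists (x :: s1), y, s2, s3.
Qed.

Variable w : V * V -> int.
Hypothesis w_pos : forall c, scycle e c -> (1 <= cyclen w c)%R.

(** A closed walk that repeats a vertex splits there into two shorter closed walks, each of weight
    at least 1 by induction, so it weighs at least 2. Hence a closed walk of weight 1 is a cycle. *)
Lemma closed_walk_ge1 c : c != [::] -> cycle e c ->
  (1 <= cyclen w c)%R /\ (cyclen w c = 1%R -> uniq c).
Proof.
have [k] := ubnP (size c); elim: k c => // k IH c Hk c0 cc.
case U: (uniq c); first by split=> //; apply: w_pos; rewrite /scycle c0 U cc.
have [s1 [y [s2 [s3 E]]]] := not_uniq_split (negbT U).
have Erot : rot (size s1) c = y :: s2 ++ y :: s3 ++ s1.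
  by rewrite E rot_size_cat /= -catA.
have Cr : cycle e (y :: s2 ++ y :: s3 ++ s1) by rewrite -Erot rot_cycle.
have Sz : size c = (size s2 + (size s3 + size s1).+1).+1.
  by rewrite -(size_rot (size s1)) Erot /= !size_cat /= size_cat.
move: Cr; rewrite /= rcons_cat rcons_cons -cat_rcons cat_path last_rcons.
case/andP=> C1 C2.
have [|||H1 _] := IH (y :: s2) => //; first by rewrite /=; lia.
have [|||H2 _] := IH (y :: s3 ++ s1) => //; first by rewrite /= size_cat; lia.
have EL : cyclen w c = (cyclen w (y :: s2) + cyclen w (y :: s3 ++ s1))%R.
  by rewrite -(cyclen_rot _ (size s1)) Erot cyclen_cat.
by split; lia.
Qed.

Lemma closed_path_ge1 x p : p != [::] -> path e x p -> last x p = x ->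
  (1 <= wlen w x p)%R.
Proof.
case/lastP: p => // p y _; rewrite last_rcons => + E; rewrite E => P.
by have [||] := @closed_walk_ge1 (x :: p).
Qed.

Lemma closed_path_ge0 x p : path e x p -> last x p = x -> (0 <= wlen w x p)%R.
Proof.
case: p => // y p P L; apply: le_trans (closed_path_ge1 _ P L) => //.
Qed.

End Scycle.

(** Strong induction with excluded middle, as [P] is an arbitrary proposition. *)
Lemma exists_least (P : nat -> Prop) :
  (exists n, P n) -> exists n, P n /\ forall k, P k -> n <= k.
Proof.
case=> n; elim/ltn_ind: n => n IH Pn.
have [[k [lt_kn Pk]]|H] := pselect (exists k, k < n /\ P k); first exact: (IH k).
exists n; split=> // k Pk; rewrite leqNgt; apply/negP => lt_kn.
by apply: H; exists k.
Qed.

(** * Integral weights for which every edge of a cycle lies on a tight cycle *)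

Section CoherentWeight.
Variables (V : finType) (e : rel V).
Hypothesis e_irr : irreflexive e.

Definition lower (w : V * V -> int) (x y : V) (d : int) (f : V * V) : int :=
  (w f - (if f == (x, y) then d else 0))%R.

Lemma wlen_lower w x y d z p :
  x \notin belast z p -> wlen (lower w x y d) z p = wlen w z p.
Proof.
elim: p z => //= t p IH z; rewrite inE negb_or => /andP[zx /IH->].
by rewrite /lower xpair_eqE eq_sym (negbTE zx) subr0.
Qed.

Lemma scycle_through c x : scycle e c -> x \in c ->
  exists i y q, rot i c = x :: y :: q.
Proof.
move=> sc xc; have [i c' E] := rot_to xc.
move: sc; rewrite -(scycle_rot _ i) E => /(scycle_size e_irr).
by case: c' E => // y q E _; exists i, y, q.
Qed.

Lemma cyclen_lower w x y d z q : scycle e (x :: z :: q) ->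
  cyclen (lower w x y d) (x :: z :: q) =
  (cyclen w (x :: z :: q) - (if z == y then d else 0))%R.
Proof.
case/and3P=> _ /andP[xq _] _.
rewrite /= wlen_lower; last by rewrite belast_rcons.
by rewrite /lower xpair_eqE eqxx /= addrAC.
Qed.

Lemma cyclen_lower_out w x y d c :
  x \notin c -> cyclen (lower w x y d) c = cyclen w c.
Proof. by case: c => // z q H; rewrite /= wlen_lower // belast_rcons. Qed.

Lemma wlen_cst1 x p : wlen (fun _ : V * V => 1%R : int) x p = (size p)%:Z%R.
Proof. by elim: p x => //= y p IH x; rewrite IH; lia. Qed.

(* The edges are treated one at a time: the weight of an edge on no tight cycle
   is lowered until one appears. This keeps every tight cycle tight, since a
   tight cycle through the edge would have prevented the change. *)
Lemma coherent_weight : exists w : V * V -> int,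
  (forall c, scycle e c -> (1 <= cyclen w c)%R) /\
  forall x y q, scycle e (x :: y :: q) ->
    exists q', scycle e (x :: y :: q') /\ cyclen w (x :: y :: q') = 1%R.
Proof.
suff H (l : seq (V * V)) : exists w : V * V -> int,
  (forall c, scycle e c -> (1 <= cyclen w c)%R) /\
  forall x y q, (x, y) \in l -> scycle e (x :: y :: q) ->
    exists q', scycle e (x :: y :: q') /\ cyclen w (x :: y :: q') = 1%R.
  have [w [H1 H2]] := H (enum {: V * V}); exists w; split=> // x y q.
  by apply: H2; rewrite mem_enum.
elim: l => [|[x y] l [w [w_pos w_tight]]].
  exists (fun=> 1%R); split=> // -[|x p] // _.
  by rewrite /= wlen_cst1 size_rcons.
have [[q0 sc0]|none] := pselect (exists q, scycle e (x :: y :: q)); last first.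
  exists w; split=> // x' y' q; rewrite inE => /orP[/eqP[-> ->] sc|].
    by case: none; exists q.
  exact: w_tight.
have [|mu [[q1 [sc1 E1]] mu_min]] := @exists_least (fun k => exists q,
    scycle e (x :: y :: q) /\ cyclen w (x :: y :: q) = k%:Z%R).
  by exists `|cyclen w (x :: y :: q0)|%N, q0; split=> //; have := w_pos _ sc0; lia.
have mu_gt0 : 0 < mu by have := w_pos _ sc1; rewrite E1; lia.
have mu_le q : scycle e (x :: y :: q) -> (mu%:Z <= cyclen w (x :: y :: q))%R.
  move=> sc; have := w_pos _ sc => w1.
  suff: mu <= `|cyclen w (x :: y :: q)|%N by lia.
  by apply: mu_min; exists q; split=> //; lia.
(* [mu] is the least weight of a cycle through [(x, y)]. Lowering the edge by [mu - 1] makes that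
   cycle tight and leaves every other cycle through it at weight at least 1. *)
pose d := (mu%:Z - 1)%R : int.
exists (lower w x y d); split=> [c sc|x' y' q].
  have := w_pos _ sc; have [xc|xc] := boolP (x \in c); last first.
    by rewrite cyclen_lower_out.
  have [i [z [q E]]] := scycle_through sc xc.
  move: sc; rewrite -(scycle_rot _ i) -(cyclen_rot w i).
  rewrite -(cyclen_rot (lower w x y d) i) E => sc.
  rewrite cyclen_lower //; case: eqP => [Ez|_]; last by rewrite subr0.
  by move: sc; rewrite Ez => /mu_le; rewrite /d; lia.
rewrite inE => /orP[/eqP[-> ->] _|xy sc].
  by exists q1; split; rewrite // cyclen_lower // eqxx E1 /d; lia.
have [q' [sc' E']] := w_tight _ _ _ xy sc; exists q'; split=> //.
have [xc|xc] := boolP (x \in x' :: y' :: q'); last by rewrite cyclen_lower_out.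
have [i [z [r E]]] := scycle_through sc' xc.
move: sc' E'; rewrite -(scycle_rot _ i) -(cyclen_rot w i).
rewrite -(cyclen_rot (lower w x y d) i) E => sc' E'.
rewrite cyclen_lower // E'; case: eqP => [Ez|_]; last by rewrite subr0.
by move: sc' E'; rewrite Ez => /mu_le + E'; rewrite E' /d; lia.
Qed.

End CoherentWeight.

(** * Covering a cycle by arcs of tight cycles *)

Lemma eqmod_small n i j : i = j %[mod n] -> i <= j -> j < i + n -> i = j.
Proof.
move=> /eqP E le_ij lt_j; move: E; rewrite eq_sym eqn_mod_dvd //.
have [|gt0] := posnP (j - i); first lia.
by move/(dvdn_leq gt0); lia.
Qed.

Section Listing.
Variables (V : finType) (a : nat -> V).

(** The start [a s] is left out, as in the arguments of [path] and [wlen]. *)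
Definition seg s t := [seq a i | i <- iota s.+1 (t - s)].

Definition arcseq s t := [seq a i | i <- iota s (t - s).+1].

Lemma arcseqE s t : arcseq s t = a s :: seg s t. Proof. by []. Qed.

Lemma mem_arcseq s t z :
  reflect (exists r, s <= r < (t - s).+1 + s /\ z = a r) (z \in arcseq s t).
Proof.
apply: (iffP mapP) => -[r]; rewrite ?mem_iota.
  by move=> Hr ->; exists r; split=> //; lia.
by case=> Hr ->; exists r; rewrite // mem_iota; lia.
Qed.

Lemma last_seg s t : s <= t -> last (a s) (seg s t) = a t.
Proof.
move=> st; rewrite /seg -(subnKC st) addKn; elim: (t - s) => [|d IH].
  by rewrite addn0.
by rewrite -[d.+1]addn1 iotaD map_cat last_cat /=; congr a; lia.
Qed.

Lemma seg_cat s r t : s <= r -> r <= t -> seg s t = seg s r ++ seg r t.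
Proof.
move=> sr rt; rewrite /seg -map_cat; congr map.
have -> : t - s = (r - s) + (t - r) by lia.
by rewrite iotaD; congr (_ ++ iota _ _); lia.
Qed.

Lemma arcseq_cat s r t : s <= r -> r <= t ->
  arcseq s t = arcseq s r ++ seg r t.
Proof. by move=> sr rt; rewrite !arcseqE (seg_cat sr rt). Qed.

Lemma path_seg (e : rel V) s t :
  (forall i, e (a i) (a i.+1)) -> path e (a s) (seg s t).
Proof.
move=> ae; rewrite /seg; move: (t - s) => d; elim: d s => //= d IH s.
by rewrite ae IH.
Qed.

Variables (M : zmodType) (w : V * V -> M).

(** A potential along the listing: the weight of a segment is the difference of its values at the
    two ends. *)
Definition cumul t := (\sum_(0 <= i < t) w (a i, a i.+1))%R.

Lemma cumulS t : cumul t.+1 = (cumul t + w (a t, a t.+1))%R.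
Proof. by rewrite /cumul big_nat_recr. Qed.

Lemma wlen_seg s t : s <= t -> wlen w (a s) (seg s t) = (cumul t - cumul s)%R.
Proof.
move=> st; rewrite /seg -{2}(subnKC st); move: (t - s) => d.
elim: d s {st} => [|d IH] s.
  by rewrite addn0 subrr.
rewrite [LHS]/= IH cumulS addSnnS opprD addrCA.
by congr (_ + _)%R; rewrite addrCA subrr addr0.
Qed.

End Listing.

(* [a] lists the vertices of a directed cycle of length [n] and weight [m],
   periodically; positions on the cycle can thus be compared as integers. *)
Record listing (V : finType) (e : rel V) (w : V * V -> int)
    (a : nat -> V) (n : nat) (m : int) : Prop := Listing {
  listing_gt0 : 0 < n;
  listing_per : forall i, a (i + n) = a i;
  listing_inj : forall i j, a i = a j -> i = j %[mod n];
  listing_edge : forall i, e (a i) (a i.+1);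
  listing_len : cumul a w n = m
}.

Section ListingTheory.
Variables (V : finType) (e : rel V) (w : V * V -> int).

Section One.
Variables (a : nat -> V) (n : nat) (m : int).
Hypothesis La : listing e w a n m.

Let n_gt0 := listing_gt0 La.
Let a_per := listing_per La.
Let a_edge := listing_edge La.

Lemma a_perM i q : a (i + q * n) = a i.
Proof. by elim: q => [|q IH]; rewrite ?addn0 // mulSn addnCA addnC a_per. Qed.

Lemma cumul_per i : cumul a w (i + n) = (cumul a w i + m)%R.
Proof.
elim: i => [|i IH]; first by rewrite add0n (listing_len La) /cumul big_geq ?add0r.
by rewrite addSn !cumulS IH -addSn !a_per addrAC.
Qed.

Lemma a_inj i j : a i = a j -> i <= j -> j < i + n -> i = j.
Proof. by move/(listing_inj La); apply: eqmod_small. Qed.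

Lemma uniq_arcseq s t : t < s + n -> uniq (arcseq a s t).
Proof.
move=> st; rewrite /arcseq map_inj_in_uniq ?iota_uniq // => i j.
rewrite !mem_iota => Hi Hj E; case: (leqP i j) => ij.
  by apply: a_inj => //; lia.
by apply/esym; apply: a_inj => //; lia.
Qed.

Definition verts := arcseq a 0 n.-1.

Lemma vertsP z s : z \in verts -> exists r, s <= r < s + n /\ z = a r.
Proof.
(* The position congruent to [r0] in the window starting at [s]; the term [s * n] keeps the
   subtraction from truncating at 0. *)
case/mem_arcseq=> r0 [_ ->]; exists (s + (r0 + s * n - s) %% n).
have sn : s <= s * n by rewrite leq_pmulr.
split; first by have := ltn_pmod (r0 + s * n - s) n_gt0; lia.
rewrite -(a_perM r0 s) -[in RHS](a_perM _ ((r0 + s * n - s) %/ n)).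
by congr a; have := divn_eq (r0 + s * n - s) n; lia.
Qed.

Lemma mem_verts r : a r \in verts.
Proof.
apply/mem_arcseq; exists (r %% n); have := ltn_pmod r n_gt0; split; first lia.
by rewrite {1}(divn_eq r n) addnC a_perM.
Qed.

Lemma arcseq_verts s t z : z \in arcseq a s t -> z \in verts.
Proof. by case/mem_arcseq=> r [_ ->]; apply: mem_verts. Qed.

Lemma scycle_arcseq s : scycle e (arcseq a s (s + n.-1)).
Proof.
rewrite /scycle uniq_arcseq ?arcseqE; last lia.
rewrite /= rcons_path path_seg // last_seg; last lia.
by rewrite -[X in e _ X]a_per (_ : s + n = (s + n.-1).+1) ?a_edge //; lia.
Qed.

End One.

Definition cyc_at (x : V) c r := nth x c (r %% size c).

Lemma cyc_atE x p i : i <= size (x :: p) ->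
  cyc_at x (x :: p) i = nth x (rcons (x :: p) x) i.
Proof.
rewrite leq_eqVlt /cyc_at => /orP[/eqP->|lt_in]; rewrite nth_rcons.
  by rewrite modnn ltnn eqxx.
by rewrite lt_in modn_small.
Qed.

(** The list is split with [x] repeated at its end, so that a segment may run up to the return to
    [x]. *)
Lemma seg_cyc_at x p d1 z d2 d3 :
  rcons (x :: p) x = d1 ++ (z :: d2) ++ d3 ->
  cyc_at x (x :: p) (size d1) = z /\
  seg (cyc_at x (x :: p)) (size d1) (size d1 + size d2) = d2.
Proof.
move=> E; have := congr1 size E; rewrite size_rcons !size_cat => szE.
have sz : (size (x :: p)).+1 = size d1 + ((size d2).+1 + size d3) by [].
split.
  rewrite cyc_atE ?E; last lia.
  by rewrite nth_cat ltnn subnn.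
apply: (@eq_from_nth _ x); rewrite size_map size_iota ?addKn // => i Hi.
rewrite (nth_map 0) ?size_iota ?addKn // nth_iota // cyc_atE ?E; last lia.
rewrite nth_cat ifN; last lia.
rewrite nth_cat ifT /=; last lia.
by have -> : (size d1).+1 + i - size d1 = i.+1 by lia.
Qed.

Lemma listing_of_scycle x p : scycle e (x :: p) ->
  listing e w (cyc_at x (x :: p)) (size (x :: p)) (cyclen w (x :: p)).
Proof.
case/and3P=> _ U C; set n := size (x :: p); set a := cyc_at _ _.
have n_gt0 : 0 < n by [].
have [a0 E] := @seg_cyc_at x p [::] x (rcons p x) [::] (esym (cats0 _)).
split=> //.
- by move=> i; rewrite /a /cyc_at modnDr.
- by move=> i j /eqP; rewrite /a /cyc_at nth_uniq ?ltn_pmod // => /eqP.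
- move=> i; have aS : a i.+1 = a (i %% n).+1.
    by rewrite /a /cyc_at -addn1 -[(i %% n).+1]addn1 modnDml.
  have ai : a i = a (i %% n) by rewrite /a /cyc_at modn_mod.
  have lt_in := ltn_pmod i n_gt0.
  rewrite aS ai /a !cyc_atE ?(ltnW lt_in) //.
  move: C => /(pathP x)/(_ (i %% n)); rewrite size_rcons => /(_ lt_in).
  by rewrite -rcons_cons.
- have W0 : cumul a w 0 = 0%R by rewrite /cumul big_geq.
  have := @wlen_seg _ a _ w 0 n (leq0n n); rewrite W0 subr0 => <-.
  have -> : seg a 0 n = rcons p x by rewrite -[RHS]E size_rcons.
  by rewrite (a0 : a 0 = x).
Qed.

End ListingTheory.

(** * Steps, return walks and chains of steps around a cycle *)

Section Steps.
Variables (V : finType) (e : rel V) (w : V * V -> int) (a : nat -> V).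

(* [step s t]: the segment of the cycle from [s] to [t] closes up to a closed
   walk of weight 1. *)
Definition step s t := s < t /\ exists p, [/\ path e (a t) p,
  last (a t) p = a s & (wlen w (a t) p + (cumul a w t - cumul a w s) = 1)%R].

(** A return walk that avoids the cycle; [L] lists its inner vertices only. *)
Definition jump n s t L := [/\ path e (a t) (rcons L (a s)),
  all (fun z => z \notin verts a n) L &
  (wlen w (a t) (rcons L (a s)) + (cumul a w t - cumul a w s) = 1)%R].

Definition chain n k (s : nat -> nat) := [/\ 0 < k, s k = s 0 + n &
  forall i, i < k -> step (s i) (s i.+1)].

(** The periodic extension of a chain, in which the starting index can be moved freely. *)
Definition pchain n k (s : nat -> nat) :=
  (forall i, s (i + k) = s i + n) /\ forall i, step (s i) (s i.+1).

End Steps.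

Lemma split_first (T : finType) (P : pred T) L : has P L ->
  exists z p1 p2, [/\ L = p1 ++ z :: p2, P z & all (predC P) p1].
Proof.
elim: L => //= x L IH; case Px: (P x) => /=; first by exists x, [::], L.
by case/IH=> z [p1 [p2 [-> Pz H]]]; exists z, (x :: p1), p2; rewrite /= Px.
Qed.

Section MinimalChain.
Variables (V : finType) (e : rel V) (w : V * V -> int) (m : int).

Section Listed.
Variables (a : nat -> V) (n : nat).
Hypothesis La : listing e w a n m.

Let a_per := listing_per La.
Let a_edge := listing_edge La.
Local Notation W := (cumul a w).
Let W_per := cumul_per La.
Local Notation step := (step e w a).

Lemma step_shift q s t : step s t -> step (s + q * n) (t + q * n).
Proof.
move=> st; elim: q => [|q IH]; first by rewrite !addn0.
rewrite mulSn ![n + _]addnC !addnA; case: IH => lt_st [p [pp lp wp]].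
split; first by rewrite ltn_add2r.
by exists p; split; rewrite ?a_per // !W_per; lia.
Qed.

(** The smaller segment is closed by going on along the cycle to [t], back to [s] by the old return
    walk, and forward to [s']; the closed walk is the same. *)
Lemma step_mono s t s' t' :
  step s t -> s <= s' -> s' < t' -> t' <= t -> step s' t'.
Proof.
case=> lt_st [p [pp lp wp]] ss' st' tt'; split=> //.
exists (seg a t' t ++ p ++ seg a s s').
rewrite !cat_path !last_cat !wlen_cat last_seg // lp last_seg // !path_seg //.
by split=> //; rewrite ?pp ?wlen_seg //; lia.
Qed.

Lemma arc_closed s t L : s <= t -> path e (a t) (rcons L (a s)) ->
  cycle e (arcseq a s t ++ L) /\
  cyclen w (arcseq a s t ++ L) =
    (W t - W s + wlen w (a t) (rcons L (a s)))%R.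
Proof.
move=> st pL; rewrite arcseqE /= rcons_cat cat_path last_seg // path_seg //=.
by rewrite wlen_cat last_seg // wlen_seg.
Qed.

Lemma jump_step s t L : s < t -> jump e w a n s t L -> step s t.
Proof.
move=> st [pL _ wL]; split=> //; exists (rcons L (a s)).
by rewrite last_rcons.
Qed.

Lemma chain_pchain k s : chain e w a n k s ->
  pchain e w a n k (fun i => s (i %% k) + i %/ k * n).
Proof.
case=> k0 sk st; split=> i; first by rewrite modnDr divnDr // divnn k0 mulnDl mul1n addnA.
have lt_ik := ltn_pmod i k0.
(* At the last residue the step ends at [s k = s 0 + n], the first position of the next round. *)
move: lt_ik; rewrite leq_eqVlt => /orP[/eqP E|lt_ik].
  have Ei : i.+1 = (i %/ k).+1 * k by rewrite {1}(divn_eq i k); lia.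
  rewrite Ei modnMl mulnK // mulSn addnA -sk.
  by apply: step_shift; have := st (i %% k); rewrite E; apply; lia.
have Ei : i.+1 = i %/ k * k + (i %% k).+1 by rewrite {1}(divn_eq i k); lia.
have -> : i.+1 %% k = (i %% k).+1 by rewrite Ei modnMDl modn_small.
have -> : i.+1 %/ k = i %/ k by rewrite {1}Ei divnMDl // (divn_small lt_ik) addn0.
by apply: step_shift; apply: st; lia.
Qed.

Hypothesis w_pos : forall c, scycle e c -> (1 <= cyclen w c)%R.

Lemma jump_uniq s t L : s <= t -> jump e w a n s t L -> uniq (arcseq a s t ++ L).
Proof.
move=> st [pL _ wL]; have [C E] := arc_closed st pL.
by have [_] := @closed_walk_ge1 V e w w_pos (arcseq a s t ++ L) isT C; apply; lia.
Qed.

Hypothesis m_ge2 : (2%:Z <= m)%R.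

(** Otherwise deleting one full turn, of weight [m], from the closed walk of weight 1 would leave a
    closed walk of negative weight. *)
Lemma step_lt s t : step s t -> t < s + n.
Proof.
case=> _ [p [pp lp wp]]; rewrite ltnNge; apply/negP => H.
have := @closed_path_ge0 V e w w_pos (a (s + n)) (seg a (s + n) t ++ p).
rewrite cat_path last_cat wlen_cat path_seg // last_seg // wlen_seg // lp.
by rewrite a_per W_per => /(_ pp erefl); lia.
Qed.

Lemma step_neq s t : step s t -> a t != a s.
Proof.
move=> st; have := step_lt st; case: st => lt_st _ lt_ts.
by apply/eqP => E; have := a_inj La (esym E); lia.
Qed.

(** The return walks are concatenated in reverse order; each contributes 1 together with its
    segment. *)
Lemma chain_walk s i : (forall i, step (s i) (s i.+1)) -> 0 < i ->
  exists p, [/\ p != [::], path e (a (s i)) p, last (a (s i)) p = a (s 0) &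
   (wlen w (a (s i)) p + (W (s i) - W (s 0%N)) = i%:Z)%R].
Proof.
move=> st; elim: i => // i IH _.
have nst := step_neq (st i); have [_ [p [pp lp wp]]] := st i.
have p0 : p != [::] by case: p pp lp wp => // _ /= E; rewrite E eqxx in nst.
have [E|i0] := posnP i; first by subst i; exists p; split.
have [p' [_ pp' lp' wp']] := IH i0; exists (p ++ p').
rewrite cat_path last_cat wlen_cat lp pp; split=> //; first by case: (p) p0.
by lia.
Qed.

Lemma pchain_gt k s : pchain e w a n k s -> 0 < k -> (m + 1 <= k%:Z)%R.
Proof.
case=> s_per s_step k0.
have [p [p0 pp lp wp]] := chain_walk s_step k0.
move: pp lp wp; rewrite -[k in s k]add0n s_per a_per W_per => pp lp wp.
have := closed_path_ge1 w_pos p0 pp lp; lia.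
Qed.

Hypothesis m_min : forall c, scycle e c ->
  cyclen w c = 1%R \/ (m <= cyclen w c)%R.

(* If the return walk of a step meets the cycle, cutting it at the first common
   vertex gives two closed walks of total weight [m + 1]: one of them has weight
   1 and covers a longer segment. Positions are shifted by [n] so that the
   enlarged segment does not start before 0. *)
Lemma step_jump s t : step s t ->
  exists s' t' L, [/\ s' <= s + n, t + n <= t', s' < t' & jump e w a n s' t' L].
Proof.
move=> st; have lt_ts := step_lt st; have nst := step_neq st.
case: st => lt_st [p [pp lp wp]].
case/lastP: p pp lp wp => [|L y]; first by move=> _ /= E; rewrite E eqxx in nst.
rewrite last_rcons => pL Ey; rewrite {y}Ey in pL * => wL; move: nst => _.
have [d] := ubnP (size L); elim: d L s t lt_st lt_ts pL wL => // d IH L s t.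
move=> lt_st lt_ts pL wL szL.
have [/split_first[z [p1 [p2 [EL zA p1A]]]]|nA] :=
    boolP (has (fun z => z \in verts a n) L); last first.
  exists (s + n), (t + n), L; split=> //; first by rewrite ltn_add2r.
  by split; rewrite ?a_per ?W_per ?all_predC //; lia.
have [C E] := arc_closed (ltnW lt_st) pL.
have U : uniq (arcseq a s t ++ L).
  by have [_] := @closed_walk_ge1 V e w w_pos (arcseq a s t ++ L) isT C; apply; lia.
have [r [Hr Ez]] := vertsP La s zA.
(* The closed walk of the step has no repeated vertex, so [z] is not on the segment from [s] to
   [t]. *)
have lt_tr : t < r.
  rewrite ltnNge; apply/negP => le_rt; move: U; rewrite cat_uniq => /and3P[_ /hasP[]].
  exists z; first by rewrite EL mem_cat inE eqxx orbT.
  by apply/mem_arcseq; exists r; split=> //; lia.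
move: pL wL; rewrite EL rcons_cat rcons_cons -cat_rcons cat_path last_rcons.
rewrite wlen_cat last_rcons.
case/andP=> pL1 pL2 wL.
have [C1 E1] : cycle e (arcseq a r (t + n) ++ p1) /\ cyclen w (arcseq a r (t + n) ++ p1) =
    (W (t + n)%N - W r + wlen w (a (t + n)) (rcons p1 (a r)))%R.
  by apply: arc_closed; rewrite ?a_per -?Ez //; lia.
have [C2 E2] : cycle e (arcseq a s r ++ p2) /\ cyclen w (arcseq a s r ++ p2) =
    (W r - W s + wlen w (a r) (rcons p2 (a s)))%R.
  by apply: arc_closed; rewrite -?Ez //; lia.
have [G2 _] := @closed_walk_ge1 V e w w_pos (arcseq a s r ++ p2) isT C2.
have S1 : scycle e (arcseq a r (t + n) ++ p1).
  apply/and3P; split=> //; rewrite cat_uniq (uniq_arcseq La) /=; last first.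
    by rewrite ltn_add2r.
  apply/andP; split.
    apply/hasPn => y /(allP p1A) /= nyA; apply/negP => /(arcseq_verts La).
    exact/negP.
  by move: U; rewrite EL cat_uniq cat_uniq => /and3P[_ _ /andP[]].
move: E1 E2; rewrite a_per -Ez W_per => E1 E2.
(* If the first cycle is tight, it gives the jump from [r] to [t + n]. Otherwise it weighs at least
   [m], so the second walk has weight 1, and the longer segment from [s] to [r] has the shorter
   return list [p2]. *)
have [H1|H1] := m_min S1.
  have lt_rn : r < t + n by clear - lt_ts Hr lt_st; lia.
  exists r, (t + n), p1; split=> //; first by case/andP: Hr => _ /ltnW.
  by split; rewrite ?a_per -?Ez ?W_per //; clear - H1 E1; lia.
have sz2 : size p2 < d by move: szL; rewrite EL size_cat /=; clear; lia.
have lt_sr : s < r by apply: ltn_trans lt_tr.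
have lt_rs : r < s + n by case/andP: Hr.
have wL2 : (wlen w z (rcons p2 (a s)) + (W r - W s) = 1)%R.
  by clear - H1 wL E1 E2 G2; lia.
rewrite Ez in pL2 wL2.
have [s' [t' [L' [H2 H3 H4 H5]]]] := IH p2 s r lt_sr lt_rs pL2 wL2 sz2.
exists s', t', L'; split=> //; apply: leq_trans H3.
by rewrite leq_add2r ltnW.
Qed.

End Listed.

(** Produces steps on a cycle given as an explicit list: the part [z :: d2] is the segment and [q]
    its return walk. *)
Lemma step_of_split x p d1 z d2 d3 q :
  scycle e (x :: p) -> rcons (x :: p) x = d1 ++ (z :: d2) ++ d3 -> d2 != [::] ->
  path e (last z d2) q -> last (last z d2) q = z ->
  (wlen w z d2 + wlen w (last z d2) q = 1)%R ->
  step e w (cyc_at x (x :: p)) (size d1) (size d1 + size d2).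
Proof.
move=> sc E d2n pq lq wq; have [az sz] := seg_cyc_at E.
have le_d : size d1 <= size d1 + size d2 by lia.
have aw : cyc_at x (x :: p) (size d1 + size d2) = last z d2.
  by rewrite -[in RHS]sz -az last_seg.
split; first by case: (d2) d2n => //= *; lia.
exists q; rewrite aw az; split=> //.
by rewrite -wlen_seg // sz az addrC.
Qed.

(** * Return paths of a minimum chain do not meet *)

Section Crossing.
Hypothesis w_pos : forall c, scycle e c -> (1 <= cyclen w c)%R.
Hypothesis m_min : forall c, scycle e c ->
  cyclen w c = 1%R \/ (m <= cyclen w c)%R.
Variable k : nat.
Hypothesis k_min : forall a n k' s,
  listing e w a n m -> chain e w a n k' s -> k <= k'.

Variables (a : nat -> V) (n : nat).
Hypothesis La : listing e w a n m.

Let a_per := listing_per La.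
Let a_edge := listing_edge La.
Local Notation W := (cumul a w).
Let W_per := cumul_per La.
Local Notation step := (step e w a).

(** Such a step would replace [j - i] steps, at least two, by a single one, against the minimality
    of [k]. *)
Lemma no_shortcut s i j : pchain e w a n k s -> i.+2 <= j -> j <= i + k ->
  ~ step (s i) (s j).
Proof.
case=> s_per s_step ij jk st.
suff: k <= k - (j - i) + 1 by lia.
pose s' l := if l is l'.+1 then s (j + l') else s i.
apply: (k_min (s := s') La); split; first lia.
  by rewrite addn1 /= -s_per; congr s; lia.
by case=> [|l] _ /=; rewrite ?addn0 // addnS.
Qed.

(** The [i]-th tight cycle is the arc from [u i] to [t i] closed by the return path [L i]. By the
    bounds below, consecutive arcs overlap, while an arc ends before the second next one begins. *)
Variables (u t : nat -> nat) (L : nat -> seq V).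
Hypothesis u_chain : pchain e w a n k u.
Hypothesis ut : forall i, u i < u i.+1 <= t i.
Hypothesis tu : forall i, t i < u i.+2.
Hypothesis L_jump : forall i, jump e w a n (u i) (t i) (L i).
Hypothesis t_per : forall i, t (i + k) = t i + n.

Lemma u_ltn i j : i < j -> u i < u j.
Proof.
elim: j => // j IH; rewrite ltnS leq_eqVlt => /orP[/eqP->|/IH ij].
  by case/andP: (ut j).
by apply: ltn_trans ij _; case/andP: (ut j).
Qed.

Lemma u_leq i j : i <= j -> u i <= u j.
Proof. by rewrite leq_eqVlt => /orP[/eqP->//|/u_ltn/ltnW]. Qed.

(** Exchanging the parts after [x] only redistributes the edges of two closed walks of weight 1. *)
Lemma cross_walks i j x p1 p2 q1 q2 : L i = p1 ++ x :: p2 -> L j = q1 ++ x :: q2 ->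
  [/\ path e (a (t i)) (rcons (p1 ++ x :: q2) (a (u j))),
      path e (a (t j)) (rcons (q1 ++ x :: p2) (a (u i))) &
   (wlen w (a (t i)) (rcons (p1 ++ x :: q2) (a (u j))) + (W (t i) - W (u i)) +
    (wlen w (a (t j)) (rcons (q1 ++ x :: p2) (a (u i))) + (W (t j) - W (u j))) = 2%:Z)%R].
Proof.
move=> Ei Ej; have [Pi _ wi] := L_jump i; have [Pj _ wj] := L_jump j.
move: Pi wi Pj wj; rewrite Ei Ej !rcons_cat !rcons_cons -!cat_rcons !cat_path !last_rcons.
rewrite !wlen_cat !last_rcons => /andP[-> ->] wi /andP[-> ->] wj.
by split=> //; lia.
Qed.

Lemma no_step i j : i.+2 <= j -> j <= i + k -> ~ step (u i) (u j).
Proof. exact: (no_shortcut u_chain). Qed.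

(** The exchanged walks close up over the arcs from [u i.+1] to [t i] and from [u i] to [t i.+1].
    Their weights add up to 2, so both are 1, and the longer arc is a shortcut from [u i] to
    [u i.+2]. *)
Lemma cross_next i x : 1 < k -> x \in L i -> x \in L i.+1 -> False.
Proof.
move=> k_gt1 /splitPr E; case Ei: _ / E => [p1 p2] /splitPr E; case Ej: _ / E => [q1 q2].
have [P1 P2 w12] := cross_walks Ei Ej.
have := ut i; have := ut i.+1; have := tu i => tui /andP[u12 ut1] /andP[u01 ut0].
have [C1 E1] := arc_closed La ut0 P1.
have le_ut : u i <= t i.+1 by lia.
have [C2 E2] := arc_closed La le_ut P2.
have [G1 _] := @closed_walk_ge1 V e w w_pos (arcseq a _ _ ++ _) isT C1.
have [G2 _] := @closed_walk_ge1 V e w w_pos (arcseq a _ _ ++ _) isT C2.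
apply: (@no_step i i.+2) => //; first lia.
apply: (step_mono La (s := u i) (t := t i.+1)) => //; try lia.
split; first lia.
by eexists; split; [exact: P2 | rewrite last_rcons | lia].
Qed.

(* The arcs of the new cycle lie in the tight cycles numbered j, ..., i + k. *)
Lemma chain_of_cross i j x p1 p2 q1 q2 : i.+2 <= j -> j < i + k ->
  L i = p1 ++ x :: p2 -> L j = q1 ++ x :: q2 ->
  let c := x :: q2 ++ arcseq a (u j) (t i + n) ++ p1 in
  scycle e c -> cyclen w c = m ->
  exists a' n' s', listing e w a' n' m /\ chain e w a' n' (i + k - j).+1 s'.
Proof.
move=> ij jk Ei Ej c sc wc; set D := i + k - j; have D0 : 0 < D by lia.
pose pre r := [seq a l | l <- iota (u j) (r - u j)].
(* Breakpoints on [c] listed from [x]: 0, the positions of [a (u (j + l))] for [l] from 1 to [D],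
   and the return to [x]. The vertex [a (u j)] stands at [(size q2).+1]. *)
pose s' l := if l is 0 then 0 else
  if l <= D then (size q2).+1 + (u (j + l) - u j) else size c.
exists (cyc_at x c), (size c), s'; split; first by rewrite -wc; apply: listing_of_scycle.
have u_per : u (i + k) = u i + n by case: u_chain.
have u_le_t : u (i + k) <= t i + n.
  by rewrite u_per leq_add2r; have /andP[/ltnW/leq_trans H /H] := ut i.
have split_arc r : u j <= r -> r <= t i + n ->
  arcseq a (u j) (t i + n) = pre r ++ a r :: seg a r (t i + n).
  move=> ur rt; rewrite /pre /seg -map_cons -map_cat /arcseq; congr map.
  have -> : (t i + n - u j).+1 = (r - u j) + (t i + n - r).+1 by lia.
  by rewrite iotaD subnKC.
have size_pre r : size (pre r) = r - u j by rewrite size_map size_iota.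
split=> // [|l]; first by rewrite /s' ltnn.
have Ec : rcons c x = (x :: q2) ++ arcseq a (u j) (t i + n) ++ rcons p1 x.
  by rewrite /c -cat_cons !rcons_cat.
have [Pi _ wi] := L_jump i; have [Pj _ wj] := L_jump j.
rewrite Ei rcons_cat rcons_cons -cat_rcons cat_path wlen_cat !last_rcons in Pi wi.
rewrite Ej rcons_cat rcons_cons -cat_rcons cat_path wlen_cat !last_rcons in Pj wj.
case/andP: Pi => Pi1 Pi2; case/andP: Pj => Pj1 Pj2.
(* The first arc runs from [x] through [q2] to [a (u j.+1)]; the rest of the tight cycle [j], ending
   with [q1], closes it. *)
case: l => [_|l lD].
  have /andP[/ltnW uj ujt] := ut j.
  have uj1 : u j.+1 <= t i + n by apply: leq_trans (u_leq _) u_le_t; lia.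
  have := @step_of_split x _ [::] x (q2 ++ arcseq a (u j) (u j.+1))
    (seg a (u j.+1) (t i + n) ++ rcons p1 x) (seg a (u j.+1) (t j) ++ rcons q1 x) sc.
  have -> : last x (q2 ++ arcseq a (u j) (u j.+1)) = a (u j.+1).
    by rewrite last_cat arcseqE /= last_seg.
  rewrite cat_path last_cat last_seg // last_rcons path_seg // arcseqE.
  rewrite wlen_splice wlen_cat last_seg // !wlen_seg //.
  have -> : s' 1 = size ([::] : seq V) + size (q2 ++ arcseq a (u j) (u j.+1)).
    by rewrite /s' D0 size_cat /= size_map size_iota addn1; lia.
  apply=> //; first by rewrite Ec (arcseq_cat _ uj uj1) arcseqE /= -!catA.
    by rewrite -size_eq0 size_cat /= addnS.
  by rewrite -wj; lia.
(* The last arc runs from [a (u (i + k))] through [p1] to [x] and is closed by [p2]; the arcs in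
   between are steps of the old chain. *)
have [lt_lD|ge_lD] := ltnP l.+1 D; last first.
  have El : l.+1 = D by lia.
  have := @step_of_split x _ (x :: q2 ++ pre (u (i + k))) (a (u (i + k)))
    (seg a (u (i + k)) (t i + n) ++ rcons p1 x) [::] (rcons p2 (a (u i))) sc.
  have uj : u j <= u i + n by rewrite -u_per; apply: u_leq; lia.
  have uk : u i + n <= t i + n by rewrite -u_per.
  rewrite last_cat !last_rcons wlen_cat last_seg // wlen_seg // u_per !a_per.
  have -> : s' l.+1 = size (x :: q2 ++ pre (u i + n)).
    by rewrite /s' El leqnn /= size_cat size_pre -u_per; congr (_ + (u _ - _)).+1; lia.
  have -> : s' l.+2 = size (x :: q2 ++ pre (u i + n)) +
       size (seg a (u i + n) (t i + n) ++ rcons p1 x).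
    rewrite /s' El ltnn; apply/eqP; rewrite -eqSS -(size_rcons c x) Ec.
    by rewrite (split_arc _ uj uk) !size_cat /= !size_cat /=; apply/eqP; lia.
  apply=> //; first by rewrite Ec (split_arc _ uj uk) a_per cats0 /= -!catA.
    by rewrite -size_eq0 size_cat size_rcons addnS.
  by rewrite !W_per; lia.
have u_step : step (u (j + l.+1)) (u (j + l.+2)).
  by rewrite [j + l.+2]addnS; case: u_chain => _; apply.
have lt_u : u (j + l.+1) < u (j + l.+2) by apply: u_ltn; lia.
have uj : u j <= u (j + l.+1) by apply: u_leq; lia.
have ui : u (j + l.+2) <= t i + n by apply: leq_trans (u_leq _) u_le_t; lia.
case: u_step => _ [q [pq lq wq]].
have := @step_of_split x _ (x :: q2 ++ pre (u (j + l.+1))) (a (u (j + l.+1)))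
  (seg a (u (j + l.+1)) (u (j + l.+2)))
  (seg a (u (j + l.+2)) (t i + n) ++ rcons p1 x) q sc.
have le_u := ltnW lt_u.
rewrite last_seg // wlen_seg //.
have -> : s' l.+1 = size (x :: q2 ++ pre (u (j + l.+1))).
  by rewrite /s' (ltnW lt_lD) /= size_cat size_pre.
have -> : s' l.+2 = size (x :: q2 ++ pre (u (j + l.+1))) +
     size (seg a (u (j + l.+1)) (u (j + l.+2))).
  by rewrite /s' lt_lD /= size_cat size_pre size_map size_iota; lia.
apply=> //; first last.
- by rewrite addrC.
- by rewrite -size_eq0 size_map size_iota; lia.
rewrite Ec (split_arc (u (j + l.+1))) //; last by lia.
by rewrite (seg_cat a le_u ui) /= -!catA /= -!catA.
Qed.

(* The two closed walks obtained by exchanging the ends of the return paths have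
   total weight [m + 2]. The first one is a cycle; if its weight is neither 1 nor
   [m], then the second one has weight 1. *)
Lemma cross_far i j x : i.+2 <= j -> j < i + k -> x \in L i -> x \in L j -> False.
Proof.
move=> ij jk xi xj.
(* Taking the first vertex of [L i] on [L j] makes [p1] avoid [L j], so that the first exchanged
   walk is a cycle. *)
have /split_first[y [p1 [p2 [Ei /= yj p1j]]]] : has (mem (L j)) (L i).
  by apply/hasP; exists x.
move: yj => /splitPr E; case Ej: _ / E => [q1 q2].
have [P1 P2 w12] := cross_walks Ei Ej.
have le_tiu : t i < u j by apply: leq_trans (tu i) (u_leq ij).
have u_per : u (i + k) = u i + n by case: u_chain.
have le_u : u j < u i + n by rewrite -u_per u_ltn.
have := ut i; have := ut j => /andP[ujj utj] /andP[u01 ut0].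
have le_u2 : u i <= t j by have := u_leq (ltnW (ltnW ij)); lia.
have [C2 E2] := arc_closed La le_u2 P2.
have le_u1 : u j <= t i + n by lia.
have P1n : path e (a (t i + n)) (rcons (p1 ++ y :: q2) (a (u j))) by rewrite a_per.
have [C1 E1] := arc_closed La le_u1 P1n.
have [G2 _] := @closed_walk_ge1 V e w w_pos (arcseq a _ _ ++ _) isT C2.
move: E1; rewrite a_per W_per => E1.
have uLi := jump_uniq La w_pos (ltnW (leq_trans u01 ut0)) (L_jump i).
have uLj := jump_uniq La w_pos (ltnW (leq_trans ujj utj)) (L_jump j).
have S1 : scycle e (arcseq a (u j) (t i + n) ++ p1 ++ y :: q2).
  apply/and3P; split=> //; rewrite cat_uniq (uniq_arcseq La) /=; last first.
    by rewrite ltn_add2r.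
  apply/andP; split.
    have [_ /allP nAi _] := L_jump i; have [_ /allP nAj _] := L_jump j.
    apply/hasPn => z Hz; apply/negP => /(arcseq_verts La); apply/negP.
    move: Hz; rewrite mem_cat => /orP[Hz|Hz].
      by apply: nAi; rewrite Ei mem_cat Hz.
    by apply: nAj; rewrite Ej mem_cat Hz orbT.
  rewrite cat_uniq; apply/and3P; split.
  - by move: uLi; rewrite Ei !cat_uniq => /and3P[_ _ /andP[]].
  - apply/hasPn => z Hz; apply/negP => /(allP p1j) /=.
    by rewrite Ej mem_cat Hz orbT.
  - by move: uLj; rewrite Ej !cat_uniq => /and3P[_ _ /and3P[]].
have utk : u (i + k).+1 <= t i + n by rewrite -t_per; case/andP: (ut (i + k)).
(* If this cycle is tight, the arc from [u j] to [t i + n] gives a shortcut from [u j] to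
   [u (i + k).+1]. *)
have [H1|H1] := m_min S1.
  have jik : j.+2 <= (i + k).+1 by rewrite !ltnS.
  apply: (no_step jik); first by rewrite -addSn leq_add2r ltnW // ltnW.
  apply: (step_mono La _ (leqnn _) (u_ltn (leqW jk)) utk).
  split; first by apply: leq_trans utk; apply: u_ltn; rewrite ltnS ltnW.
  rewrite a_per W_per.
  by eexists; split; [exact: P1 | rewrite last_rcons | clear - H1 E1; lia].
have [H2|H2] := eqVneq (cyclen w (arcseq a (u j) (t i + n) ++ p1 ++ y :: q2)) m.
  have Er : rot (size (arcseq a (u j) (t i + n) ++ p1))
     (arcseq a (u j) (t i + n) ++ p1 ++ y :: q2) =
     y :: q2 ++ arcseq a (u j) (t i + n) ++ p1.
    by rewrite catA rot_size_cat.
  have [||a' [n' [s' [La' Hs']]]] := chain_of_cross ij jk Ei Ej.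
  - by rewrite -Er scycle_rot.
  - by rewrite -Er cyclen_rot.
  (* The minimality of [k] is over all cycles of weight [m], hence covers the new one, whose chain
     has fewer than [k] steps. *)
  by have := k_min La' Hs'; clear - ij jk; lia.
have ij1 : i < j.+1 by rewrite ltnS ltnW // ltnW.
apply: (@no_step i j.+1) => //; first by rewrite ltnS ltnW.
apply: (step_mono La _ (leqnn _) (u_ltn ij1) utj).
split; first exact: leq_trans (u_ltn ij1) utj.
by eexists; split; [exact: P2 | rewrite last_rcons | clear - H1 H2 E1 E2 G2 w12; lia].
Qed.

End Crossing.

End MinimalChain.

(** * The weak double cycle *)

Lemma next_split (T : eqType) s1 (x y : T) s2 :
  uniq (s1 ++ x :: y :: s2) -> next (s1 ++ x :: y :: s2) x = y.
Proof. by move=> U; rewrite -(next_rot (size s1) U) rot_size_cat /= eqxx. Qed.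

(** * Directed cycles as digraphs *)

Section CycleDigraph.
Variables (V : finType) (G : digraph V).

Definition edge : rel V := fun x y => (x, y) \in eset G.

Lemma edge_irr : irreflexive edge.
Proof. by move=> x; apply/negbTE/eset_loopless. Qed.

(** Intersecting with [eset G] excludes loops for every list [c]; when [c] is a cycle of [G], no
    pair is lost. *)
Definition cycle_eset c := [set f in eset G | (f.1 \in c) && (f.2 == next c f.1)].

Lemma mem_cycle_eset c x y :
  ((x, y) \in cycle_eset c) = [&& edge x y, x \in c & y == next c x].
Proof. by rewrite inE. Qed.

Lemma cycle_eset_vset c x y :
  (x, y) \in cycle_eset c -> (x \in [set z in c]) && (y \in [set z in c]).
Proof. by rewrite !inE /= => /and3P[_ xc /eqP->]; rewrite mem_next xc. Qed.

Lemma cycle_eset_loopless c x : (x, x) \notin cycle_eset c.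
Proof. by rewrite inE (negbTE (eset_loopless G x)). Qed.

Definition cycle_digraph c := Digraph (@cycle_eset_vset c) (@cycle_eset_loopless c).

Lemma cycle_digraph_eset c : scycle edge c ->
  eset (cycle_digraph c) = [set (x, next c x) | x in c].
Proof.
case/and3P=> _ U C; apply/setP=> -[x y]; rewrite inE /=.
apply/idP/imsetP => [/and3P[_ xc /eqP->]|[z zc [-> ->]]]; first by exists x.
by rewrite zc eqxx !andbT; apply: next_cycle C zc.
Qed.

Lemma cycle_digraph_dcycle c : scycle edge c -> is_dcycle (cycle_digraph c).
Proof.
move=> sc; exists c; split=> //; first by case/and3P: sc.
  exact: scycle_size edge_irr _ sc.
exact: cycle_digraph_eset.
Qed.

Lemma cycle_digraph_sub c : scycle edge c -> subdigraph (cycle_digraph c) G.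
Proof.
case/and3P=> _ _ C; split; apply/subsetP => x; rewrite inE; last by case/andP.
by move=> /(next_cycle C) /eset_vset/andP[].
Qed.

Lemma cycle_digraph_sum (M : zmodType) (w : V * V -> M) c : scycle edge c ->
  (\sum_(f in eset (cycle_digraph c)) w f = cyclen w c)%R.
Proof.
move=> sc; have [_ U _] := and3P sc; rewrite (cycle_digraph_eset sc).
rewrite big_imset /=; last by move=> x y _ _ [].
by rewrite -big_uniq // cyclen_next.
Qed.

End CycleDigraph.

Lemma zip_arcseq (T : finType) (a : nat -> T) s t :
  zip (arcseq a s t) (seg a s t) = [seq (a r, a r.+1) | r <- iota s (t - s)].
Proof.
rewrite /arcseq /seg; move: (t - s) => d.
by elim: d s => //= d IH s; rewrite -IH.
Qed.

(** * Intersections of the tight cycles of a minimum chain *)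

Section DoubleCycle.
Variables (V : finType) (G : digraph V) (w : V * V -> int).
Local Notation e := (edge G).
Hypothesis w_pos : forall c, scycle e c -> (1 <= cyclen w c)%R.
Variable m : int.
Hypothesis m_min : forall c, scycle e c ->
  cyclen w c = 1%R \/ (m <= cyclen w c)%R.
Variable k : nat.
Hypothesis k_ge3 : 2 < k.
Hypothesis k_min : forall a n k' s,
  listing e w a n m -> chain e w a n k' s -> k <= k'.

Variables (a : nat -> V) (n : nat).
Hypothesis La : listing e w a n m.
Let a_per := listing_per La.
Let a_edge := listing_edge La.

Variables (u t : nat -> nat) (L : nat -> seq V).
Hypothesis u_chain : pchain e w a n k u.
Hypothesis ut : forall i, u i < u i.+1 <= t i.
Hypothesis tu : forall i, t i < u i.+2.
Hypothesis L_jump : forall i, jump e w a n (u i) (t i) (L i).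
Hypothesis t_per : forall i, t (i + k) = t i + n.
Hypothesis L_per : forall i, L (i + k) = L i.

Let u_per : forall i, u (i + k) = u i + n.
Proof. by case: u_chain. Qed.

Let u_lt := u_ltn ut.
Let u_le := u_leq ut.

Lemma ut_lt i : u i < t i.
Proof. by case/andP: (ut i); apply: leq_trans. Qed.

Lemma t_lt i : t i < t i.+1.
Proof. by apply: leq_trans (tu i) _; case/andP: (ut i.+1). Qed.

Lemma t_lt_period i : t i < u i + n.
Proof. by rewrite -u_per; apply: leq_trans (tu i) (u_le _); lia. Qed.

Definition tight i := arcseq a (u i) (t i) ++ L i.

Lemma tight_scycle i : scycle e (tight i).
Proof.
have ui := ltnW (ut_lt i); have [P _ _] := L_jump i.
have [C _] := arc_closed La ui P.
by apply/and3P; split=> //; apply: (jump_uniq La w_pos ui (L_jump i)).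
Qed.

Lemma tight_per i : tight (i + k) = tight i.
Proof.
rewrite /tight L_per u_per t_per /arcseq subnDr; congr (_ ++ _).
rewrite addnC iotaDl -map_comp; apply: eq_map => r /=.
by rewrite addnC a_per.
Qed.

Lemma tight_mod i : tight (i %% k) = tight i.
Proof.
rewrite [in RHS](divn_eq i k) addnC; elim: (i %/ k) => [|q IH]; first by rewrite addn0.
by rewrite mulSn addnCA addnC tight_per.
Qed.

Lemma mem_tight_arc i r : u i <= r <= t i -> a r \in tight i.
Proof.
move=> Hr; rewrite mem_cat; apply/orP; left; apply/mem_arcseq; exists r.
by split=> //; lia.
Qed.

(** Return paths are pairwise disjoint and avoid the listed cycle, so a common vertex lies on both
    arcs, and arcs overlap only for cyclically consecutive indices. *)
Lemma tight_meet i j v : i < j -> j < i + k -> v \in tight i -> v \in tight j ->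
  exists r, v = a r /\
   (j = i.+1 /\ u j <= r <= t i \/ j.+1 = i + k /\ u j.+1 <= r <= t j).
Proof.
move=> ij jk; have [_ /allP Ai _] := L_jump i; have [_ /allP Aj _] := L_jump j.
rewrite !mem_cat => /orP[vi|vi] /orP[vj|vj]; first last.
- have [ij1|ij1] := ltnP i.+1 j.
    by case: (cross_far w_pos m_min k_min La u_chain ut tu L_jump t_per ij1 jk vi vj).
  have Ej : j = i.+1 by apply/eqP; rewrite eqn_leq ij1 ij.
  rewrite Ej in vj.
  by case: (cross_next w_pos k_min La u_chain ut tu L_jump (ltnW k_ge3) vi vj).
- by have := arcseq_verts La vj; rewrite (negbTE (Ai _ vi)).
- by have := arcseq_verts La vi; rewrite (negbTE (Aj _ vj)).
have {vi} /mem_arcseq[r [Hr Ev]] := vi; have {vj} /mem_arcseq[r' [Hr' Ev']] := vj.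
have := ut_lt i; have := ut_lt j; have := u_lt ij; have := u_per i => upi uij utj uti.
have := tu i; have := tu j => tuj tui.
have next_le l : l.+2 <= j -> t l < u j by move=> H; apply: leq_trans (tu l) (u_le H).
have next_ge : j.+2 <= i + k -> t j < u i + n.
  by move=> H; rewrite -u_per; apply: leq_trans (tu j) (u_le H).
(* The positions are congruent modulo [n]. The bounds leave only [r' = r], where [j] follows [i],
   and [r' = r + n], where the overlap is across the end of the period. *)
have [le_rr|lt_rr] := leqP r r'.
  have [lt_r|ge_r] := ltnP r' (r + n).
    have E : r = r' by apply: (a_inj La) => //; rewrite -Ev -Ev'.
    exists r; split=> //; left.
    have ji : j <= i.+1.
      by rewrite leqNgt; apply/negP => /next_le; clear - E Hr Hr' uti utj; lia.
    have Ej : j = i.+1 by clear - ij ji; lia.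
    by split=> //; clear - E Hr Hr' uti utj; lia.
  have lt_r : r' < r + n + n.
    have := @u_le j.+2 (i.+1 + k); rewrite u_per.
    by have := ut i; have := t_lt_period i; clear - jk tuj Hr Hr' uti utj; lia.
  have E : r + n = r' by apply: (a_inj La) => //; rewrite a_per -Ev -Ev'.
  exists r'; split=> //; right.
  have jik : i + k <= j.+1.
    by rewrite leqNgt; apply/negP => /next_ge; clear - E Hr Hr' uti utj; lia.
  have Ej : j.+1 = i + k by clear - jk jik; lia.
  by rewrite Ej u_per; split=> //; clear - E Hr Hr' uti utj; lia.
have E : r' = r.
  apply: (a_inj La) (ltnW lt_rr) _; first by rewrite -Ev -Ev'.
  have := @u_lt i.+2 (i.+1 + k).
  have := @u_le i.+1 j; rewrite u_per; clear - ij k_ge3 tui Hr Hr' uti utj; lia.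
by rewrite E ltnn in lt_rr.
Qed.

(** Pairwise adjacency of the three indices forces [k = 3]; then [v] has two positions, one in each
    of two successive overlaps, which differ by less than [n]. *)
Lemma no_triple i j l v : i < j -> j < l -> l < k ->
  v \in tight i -> v \in tight j -> v \in tight l -> False.
Proof.
move=> ij jl lk vi vj vl.
have [|r1 [E1 H1]] := tight_meet ij _ vi vj; first by clear - jl lk; lia.
have [|r2 [E2 H2]] := tight_meet jl _ vj vl; first by clear - lk; lia.
have [|r3 [E3 H3]] := tight_meet (ltn_trans ij jl) _ vi vl; first by clear - lk; lia.
case: H1 => -[Ej H1]; last by clear - Ej jl lk; lia.
case: H2 => -[El H2]; last by clear - El ij lk; lia.
case: H3 => -[El3 H3]; first by clear - El El3 Ej; lia.
have := tu i; have := tu j; have := u_per i; rewrite -El3 El Ej => up tuj tui.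
have lt12 : r1 < r2 by move: H1 H2; rewrite El Ej; clear - tui; lia.
have := a_inj La (etrans (esym E1) E2) (ltnW lt12).
have lt_r : r2 < r1 + n.
  have := @u_lt i i.+1 (ltnSn i); move: H1 H2; rewrite El Ej; clear - tuj up; lia.
by move=> /(_ lt_r) E; rewrite E ltnn in lt12.
Qed.

Definition cyc (i : 'I_k) := cycle_digraph G (tight i).

Lemma cyc_ordS i : cyc (ordS i) = cycle_digraph G (tight i.+1).
Proof. by rewrite /cyc /= tight_mod. Qed.

Lemma next_tight i r : u i <= r -> r < t i -> next (tight i) (a r) = a r.+1.
Proof.
move=> ur rt; have /and3P[_ U _] := tight_scycle i.
have E : tight i = [seq a l | l <- iota (u i) (r - u i)] ++
   a r :: a r.+1 :: (seg a r.+1 (t i) ++ L i).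
  rewrite /tight (arcseq_cat a ur (ltnW rt)) (seg_cat a (leqnSn r) rt).
  have -> : seg a r r.+1 = [:: a r.+1] by rewrite /seg subSnn.
  rewrite /arcseq -addn1 iotaD map_cat subnKC //= -!catA /=.
  by [].
by rewrite E next_split // -E.
Qed.

Lemma meet_next i v : v \in tight i -> v \in tight i.+1 ->
  exists r, v = a r /\ u i.+1 <= r <= t i.
Proof.
move=> v1 v2; have [|r [Ev [[_ H]|[H _]]]] := tight_meet (ltnSn i) _ v1 v2.
- by clear - k_ge3; lia.
- by exists r.
- by clear - H k_ge3; lia.
Qed.

Lemma cyc_path i : is_dpath (dcap (cyc i) (cyc (ordS i))).
Proof.
rewrite cyc_ordS; exists (a (u i.+1)), (seg a (u i.+1) (t i)).
have /andP[u1 u2] := ut i; have tt := t_lt i; have := tu i => tui.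
rewrite -arcseqE zip_arcseq; split.
- apply: (uniq_arcseq La); have := @u_lt i.+2 (i.+1 + k).
  by rewrite u_per; clear - k_ge3 tui; lia.
- apply/setP=> v; rewrite !inE; apply/andP/mem_arcseq => [[v1 v2]|[r [Hr ->]]].
    by have [r [-> Hr]] := meet_next v1 v2; exists r; split=> //; clear - Hr; lia.
  by split; apply: mem_tight_arc; clear - Hr u1 u2 tt; lia.
apply/setP=> -[y z] /=; rewrite in_setI !mem_cycle_eset in_set; apply/idP/mapP.
  case/andP=> /and3P[_ y1 /eqP Ez] /and3P[_ y2 /eqP Ez'].
  have [r [Ey Hr]] := meet_next y1 y2.
  have [lt_rt|ge_rt] := ltnP r (t i).
    exists r; first by rewrite mem_iota; clear - Hr lt_rt; lia.
    by rewrite Ez Ey next_tight //; clear - Hr u1; lia.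
  (* No common edge leaves [a (t i)]: its head in [tight i.+1] is [a (t i).+1], beyond the overlap,
     but a vertex of both cycles has a position in the overlap. *)
  have Er : r = t i by clear - Hr ge_rt; lia.
  have z1 : z \in tight i by rewrite Ez mem_next.
  have z2 : z \in tight i.+1 by rewrite Ez' mem_next.
  have [r' [Ez2 Hr']] := meet_next z1 z2.
  move: Ez'; rewrite Ez2 Ey Er next_tight // => E.
  have := a_inj La E; case: Hr' => /andP[Hr1 Hr2].
  rewrite (leqW Hr2) => /(_ isT) H; suff: r' = (t i).+1 by clear - Hr2; lia.
  apply: H; have := @u_lt i.+2 (i.+1 + k); rewrite u_per; clear - Hr1 k_ge3 tui; lia.
case=> r; rewrite mem_iota => Hr [-> ->]; rewrite [edge _ _ _]a_edge.
have Hr1 : u i <= r by clear - Hr u1; lia.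
have Hr2 : r < t i by clear - Hr u2; lia.
have Hr3 : u i.+1 <= r by clear - Hr; lia.
rewrite !next_tight ?eqxx ?(ltn_trans Hr2 tt) // !mem_tight_arc //.
  by rewrite Hr3 /= ltnW // (ltn_trans Hr2 tt).
by rewrite Hr1 ltnW.
Qed.

Lemma cyc_disjoint (i j : 'I_k) : j != ord_pred i -> j != i -> j != ordS i ->
  [disjoint vset (cyc i) & vset (cyc j)].
Proof.
move=> jp ji js; rewrite disjoint_subset; apply/subsetP=> v; rewrite !inE => vi.
apply/negP => vj; have ik := ltn_ord i; have jk := ltn_ord j.
move: ji; rewrite -val_eqE /= neq_ltn => /orP[ji|ij].
  have [|r [_ [[H _]|[H _]]]] := tight_meet ji _ vj vi; first by clear - ik; lia.
    case/negP: jp; apply/eqP/val_inj => /=.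
    by rewrite H addSn /= modnDr modn_small.
  case/negP: js; apply/eqP/val_inj => /=.
  have [E0 ->] : j = 0 :> nat /\ i.+1 = k by clear - H ik; lia.
  by rewrite modnn.
have [|r [_ [[H _]|[H _]]]] := tight_meet ij _ vi vj; first by clear - jk; lia.
  case/negP: js; apply/eqP/val_inj => /=.
  by rewrite -H modn_small.
case/negP: jp; apply/eqP/val_inj => /=.
by rewrite -H modn_small.
Qed.

Lemma double_cycle_of_chain :
  exists (H : digraph V) (k : nat),
    [/\ subdigraph H G, 3 <= k & weak_double_cycle k H].
Proof.
have vs x y : (x, y) \in \bigcup_(i < k) eset (cyc i) ->
    (x \in \bigcup_(i < k) vset (cyc i)) && (y \in \bigcup_(i < k) vset (cyc i)).
  case/bigcupP=> i _ /eset_vset/andP[xi yi].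
  by apply/andP; split; apply/bigcupP; exists i.
have sub i := cycle_digraph_sub (tight_scycle i).
have ll x : (x, x) \notin \bigcup_(i < k) eset (cyc i).
  by apply/bigcupP=> -[i _]; apply/negP/eset_loopless.
exists (Digraph vs ll), k; split=> //.
  by split; apply/bigcupsP=> i _; case: (sub i).
exists cyc; split=> //.
- by move=> i; apply/cycle_digraph_dcycle/tight_scycle.
- move=> v; rewrite leqNgt; apply/negP => /card_gt2P[x [y [z [[]]]]].
  rewrite !inE => vx vy vz [xy yz zx].
  have nt := @no_triple _ _ _ v; have := ltn_ord x; have := ltn_ord y; have := ltn_ord z.
  move: xy yz zx; rewrite -!val_eqE /= => xy yz zx kz ky kx.
  case: (ltngtP x y) xy => // xy _; case: (ltngtP y z) yz => // yz _;
  case: (ltngtP z x) zx => // zx _.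
  + by clear - xy yz zx; lia.
  + exact: (nt x y z).
  + exact: (nt z x y).
  + exact: (nt x z y).
  + exact: (nt y z x).
  + exact: (nt y x z).
  + exact: (nt z y x).
  + by clear - xy yz zx; lia.
- exact: cyc_path.
- exact: cyc_disjoint.
Qed.

End DoubleCycle.

(** * Choosing a minimum chain and enlarging its arcs *)

Lemma jump_shift (V : finType) (e : rel V) w m a n s t L q :
  listing e w a n m -> jump e w a n s t L -> jump e w a n (s + q * n) (t + q * n) L.
Proof.
move=> La [P A E]; elim: q => [|q [P' _ E']]; first by rewrite !addn0.
rewrite mulSn ![n + _]addnC !addnA.
by split; rewrite ?(listing_per La) ?(cumul_per La) //; lia.
Qed.

Section Existence.
Variables (V : finType) (G : digraph V).
Local Notation e := (edge G).

Lemma double_cycle_of_heavy (w : V * V -> int) c :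
  (forall c, scycle e c -> (1 <= cyclen w c)%R) ->
  (forall x y q, scycle e (x :: y :: q) ->
     exists q', scycle e (x :: y :: q') /\ cyclen w (x :: y :: q') = 1%R) ->
  scycle e c -> cyclen w c != 1%R ->
  exists (H : digraph V) (k : nat),
    [/\ subdigraph H G, 3 <= k & weak_double_cycle k H].
Proof.
move=> w_pos w_tight sc wc1.
have [|m0 [[m0_ge2 [c0 [sc0 wc0]]] m0_min]] := @exists_least (fun m0 => 2 <= m0 /\
    exists c, scycle e c /\ cyclen w c = m0%:Z%R).
  exists `|cyclen w c|%N; have := w_pos _ sc => w1.
  by split; [lia | exists c; split=> //; lia].
pose m : int := m0%:Z%R.
have m_ge2 : (2%:Z <= m)%R by rewrite /m; lia.
have m_min c1 : scycle e c1 -> cyclen w c1 = 1%R \/ (m <= cyclen w c1)%R.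
  move=> sc1; have w1 := w_pos _ sc1.
  have [->|w2] := eqVneq (cyclen w c1) 1%R; first by left.
  right; suff: m0 <= `|cyclen w c1|%N by rewrite /m; lia.
  by apply: m0_min; split; [lia | exists c1; split=> //; lia].
have [|k [[a [n [s [La s_chain]]]] k_min0]] := @exists_least (fun k => exists a n s,
    listing e w a n m /\ chain e w a n k s).
  have c0_size := scycle_size (@edge_irr V G) sc0.
  case: c0 sc0 wc0 c0_size => // x p sc0 wc0 c0_size.
  have La := listing_of_scycle w sc0; rewrite wc0 -/m in La.
  move: La c0_size; set a := cyc_at _ _; set n := size _ => La c0_size.
  (* Some chain exists: every edge lies on a tight cycle, so the single edges of the cycle are [n]
     steps. *)
  exists n, a, n, id; split=> //; split=> [||i _]; [exact: listing_gt0 La | by [] |].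
  have := scycle_arcseq La i.
  have -> : arcseq a i (i + n.-1) = a i :: a i.+1 :: seg a i.+1 (i + n.-1).
    by rewrite (@arcseq_cat _ a i i.+1) /arcseq ?subSnn //; lia.
  case/w_tight=> q [/and3P[_ _ /= /andP[_ Pq]] Eq]; split=> //.
  exists (rcons q (a i)); rewrite last_rcons cumulS; split=> //.
  by move: Eq => /=; lia.
have k_min a' n' k' s' : listing e w a' n' m -> chain e w a' n' k' s' -> k <= k'.
  by move=> La' s'_chain; apply: k_min0; exists a', n', s'.
have [k_gt0 _ _] := s_chain.
have := chain_pchain La s_chain; move: (fun i => _) => {s s_chain} s s_chain.
have k_ge3 : 2 < k.
  by have := pchain_gt La w_pos m_ge2 s_chain k_gt0; clear - m_ge2; lia.
have [s_per s_step] := s_chain.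
have /choice[f Hf] i : exists J : nat * nat * seq V,
    [/\ J.1.1 <= s i + n, s i.+1 + n <= J.1.2, J.1.1 < J.1.2 &
     jump e w a n J.1.1 J.1.2 J.2].
  have [s' [t' [L' H]]] := step_jump La w_pos m_ge2 m_min (s_step i).
  by exists (s', t', L').
(* The chosen jumps need not be periodic in [i]; only those for the residues modulo [k] are kept,
   and shifted by multiples of [n]. *)
pose u i := (f (i %% k)).1.1 + i %/ k * n; pose t i := (f (i %% k)).1.2 + i %/ k * n.
pose L i := (f (i %% k)).2.
have s_perM i q : s (i + q * k) = s i + q * n.
  elim: q => [|q IH]; first by rewrite !addn0.
  by rewrite mulSn addnCA addnC s_per IH mulSn addnAC addnA.
have s_mod i : s i = s (i %% k) + i %/ k * n.
  by rewrite -s_perM; congr s; rewrite {1}(divn_eq i k) addnC.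
have s_modS i : s i.+1 = s (i %% k).+1 + i %/ k * n.
  by rewrite -s_perM; congr s; rewrite {1}(divn_eq i k) addSn addnC.
have Hu i : u i <= s i + n.
  by have [H _ _ _] := Hf (i %% k); rewrite s_mod addnAC leq_add2r.
have Ht i : s i.+1 + n <= t i.
  by have [_ H _ _] := Hf (i %% k); rewrite s_modS addnAC leq_add2r.
have Hut i : u i < t i by have [_ _ H _] := Hf (i %% k); rewrite ltn_add2r.
have L_jump i : jump e w a n (u i) (t i) (L i).
  by have [_ _ _ H] := Hf (i %% k); apply: (jump_shift _ La).
have per i : (i + k) %/ k = (i %/ k).+1 by rewrite divnDr // divnn k_gt0 addn1.
have u_per i : u (i + k) = u i + n by rewrite /u modnDr per mulSn addnCA addnC.
have t_per i : t (i + k) = t i + n by rewrite /t modnDr per mulSn addnCA addnC.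
have L_per i : L (i + k) = L i by rewrite /L modnDr.
clearbody u t L.
have J_step i := jump_step (Hut i) (L_jump i).
have s_lt i : s i < s i.+1 by case: (s_step i).
have ut i : u i < u i.+1 <= t i.
  (* If [u i.+1 <= u i], the jump numbered [i.+1] covers two steps of the shifted chain [s], a
     shortcut. *)
  rewrite andbC (leq_trans (Hu _) (Ht _)) /= ltnNge; apply/negP => le_u.
  have le_s : u i.+1 <= s (i + k) by rewrite s_per; apply: leq_trans le_u (Hu i).
  have le_t : s (i.+2 + k) <= t i.+1 by rewrite s_per.
  have lt_s : s (i + k) < s (i.+2 + k).
    by rewrite !addSn; apply: ltn_trans (s_lt _) (s_lt _).
  have := step_mono La (J_step i.+1) le_s lt_s le_t.
  by apply: (no_shortcut k_min La s_chain); rewrite ?addSn //; clear - k_ge3; lia.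
have u_chain : pchain e w a n k u.
  split=> // i; have /andP[u1 u2] := ut i.
  exact: (step_mono La (J_step i) (leqnn (u i)) u1 u2).
have tu i : t i < u i.+2.
  rewrite ltnNge; apply/negP => le_u.
  have /andP[u1 _] := ut i; have /andP[u2 _] := ut i.+1.
  have := step_mono La (J_step i) (leqnn (u i)) (ltn_trans u1 u2) le_u.
  by apply: (no_shortcut k_min La u_chain) => //; clear - k_ge3; lia.
exact: (double_cycle_of_chain w_pos m_min k_ge3 k_min La u_chain ut tu L_jump t_per
  L_per).
Qed.

Lemma unit_weight : ~ (exists (H : digraph V) (k : nat),
    [/\ subdigraph H G, 3 <= k & weak_double_cycle k H]) ->
  exists w : V * V -> int, forall c, scycle e c -> cyclen w c = 1%R.
Proof.
move=> no; have [w [w_pos w_tight]] := coherent_weight (@edge_irr V G).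
exists w => c sc; apply/eqP; apply: contra_notT no => wc.
exact: (double_cycle_of_heavy w_pos w_tight sc wc).
Qed.

End Existence.

(** * Weak double cycles have no weighting *)

Section Arcs.
Variables (V : finType) (e : rel V) (M : zmodType) (w : V * V -> M).

(** [arc c x y] stops before [y], which is appended to count the last edge. *)
Definition arclen c x y :=
  if rcons (arc c x y) y is z :: p then wlen w z p else 0%R.

Lemma arc_cons c x y : uniq c -> x \in c -> y \in c -> x != y ->
  cycle e c -> exists p, [/\ arc c x y = x :: p, path e x (rcons p y) &
    arclen c x y = wlen w x (rcons p y)].
Proof.
move=> U xc yc xy C; rewrite /arclen; have [i p1 p2 <- _ E] := rot_to_arc U xc yc xy.
exists p1; split=> //.
by move: C; rewrite -(rot_cycle i) E /= rcons_cat /= -cat_rcons cat_path => /andP[].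
Qed.

Lemma arclen_add c x y : uniq c -> x \in c -> y \in c -> x != y ->
  (arclen c x y + arclen c y x)%R = cyclen w c.
Proof.
move=> U xc yc xy; rewrite /arclen.
have [i p1 p2 <- <- E] := rot_to_arc U xc yc xy.
by rewrite -(cyclen_rot w i) E cyclen_cat.
Qed.

Lemma arc_sub (c : seq V) x y : uniq c -> x \in c -> y \in c -> x != y ->
  {subset arc c x y <= c}.
Proof.
move=> U xc yc xy z; have [i p1 p2 <- _ E] := rot_to_arc U xc yc xy.
by move=> zp; rewrite -(mem_rot i) E -cat_cons mem_cat zp.
Qed.

Lemma arc_disjoint (c : seq V) x y z : uniq c -> x \in c -> y \in c -> x != y ->
  z \in arc c x y -> z \in arc c y x -> False.
Proof.
move=> U xc yc xy; have [i p1 p2 <- <- E] := rot_to_arc U xc yc xy.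
move: U; rewrite -(rot_uniq i) E -cat_cons cat_uniq => /and3P[_ /hasPn H _] z1 z2.
by have := H _ z2; rewrite /= z1.
Qed.

Lemma arc_next (c : seq V) x y z : uniq c -> x \in c -> y \in c -> x != y ->
  z \in arc c x y -> next c z != y -> next c z \in arc c x y.
Proof.
move=> U xc yc xy; have [i p1 p2 <- _ E] := rot_to_arc U xc yc xy.
rewrite -(next_rot i U); have {U} := U; rewrite -(rot_uniq i) E -cat_cons => U.
case/splitPr def_p: _ / => [s1 s2]; move: U; rewrite def_p -catA cat_cons.
case: s2 def_p => [|t s2] _ U.
  by rewrite next_split ?eqxx.
by rewrite cat_cons next_split // mem_cat !inE eqxx !orbT.
Qed.

Lemma mem_arc_start (c : seq V) x y : uniq c -> x \in c -> y \in c -> x != y ->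
  x \in arc c x y.
Proof.
by move=> U xc yc xy; have [i p1 p2 <- _ _] := rot_to_arc U xc yc xy; apply: mem_head.
Qed.

(** A walk that follows [next c] can leave the arc only through [y]. *)
Lemma path_in_arc (c : seq V) x y s p : uniq c -> x \in c -> y \in c -> x != y ->
  s \in arc c x y -> {in zip (s :: p) p, forall f, f.2 = next c f.1} ->
  y \notin p -> {subset s :: p <= arc c x y}.
Proof.
move=> U xc yc xy; elim: p s => [|t p IH] s sa H.
  by move=> _ z; rewrite inE => /eqP->.
rewrite inE negb_or => /andP[yt yp] z; rewrite inE => /orP[/eqP->//|].
have E : t = next c s by apply: (H (s, t)); rewrite /= inE eqxx.
apply: IH => //; first by rewrite E arc_next // -E eq_sym.
by move=> f Hf; apply: H; rewrite /= inE Hf orbT.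
Qed.

(** The arcs are concatenated. As [arc] omits its final vertex, no junction is repeated, and
    disjointness of the arcs makes the result a cycle. *)
Lemma scycle_of_arcs k (cc : nat -> seq V) (X : nat -> V) : 0 < k -> X k = X 0 ->
  (forall i, i < k -> [/\ uniq (cc i), cycle e (cc i), X i \in cc i,
     X i.+1 \in cc i & X i != X i.+1]) ->
  (forall i j z, i < j -> j < k -> z \in arc (cc i) (X i) (X i.+1) ->
     z \in arc (cc j) (X j) (X j.+1) -> False) ->
  exists c, scycle e c /\
    cyclen w c = (\sum_(i < k) arclen (cc i) (X i) (X i.+1))%R.
Proof.
move=> k0 Xk Hc disj; pose A i := arc (cc i) (X i) (X i.+1).
pose F l := flatten [seq A i | i <- iota 0 l].
have FS l : F l.+1 = F l ++ A l.
  by rewrite /F -addn1 iotaD map_cat flatten_cat /= cats0.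
have memF l z : z \in F l -> exists2 i, i < l & z \in A i.
  by case/flatten_mapP=> i; rewrite mem_iota => Hi zi; exists i.
have UF l : l <= k -> uniq (F l).
  elim: l => // l IH lk; rewrite FS cat_uniq IH ?(ltnW lk) //=.
  have [U _ _ _ _] := Hc _ lk; apply/andP; split; last first.
    have [_ _ x1 x2 x3] := Hc _ lk; rewrite /A.
    have [i p1 p2 <- _ E] := rot_to_arc U x1 x2 x3.
    by move: U; rewrite -(rot_uniq i) E -cat_cons cat_uniq => /and3P[].
  apply/hasPn => z zl; apply/negP => /memF[i il zi].
  exact: (disj i l z il lk zi zl).
have PF l : l <= k -> exists q, [/\ rcons (F l) (X l) = X 0 :: q, path e (X 0) q,
    last (X 0) q = X l & wlen w (X 0) q = (\sum_(i < l) arclen (cc i) (X i) (X i.+1))%R].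
  elim: l => [_|l IH lk]; first by exists [::]; rewrite big_ord0.
  have [q [Eq Pq Lq Wq]] := IH (ltnW lk).
  have [U C x1 x2 x3] := Hc _ lk; have [p [Ep Pp Wp]] := arc_cons U x1 x2 x3 C.
  exists (q ++ rcons p (X l.+1)); rewrite FS /A Ep rcons_cat rcons_cons -cat_rcons Eq.
  by rewrite cat_path Pq Lq Pp last_cat last_rcons wlen_cat Lq Wq big_ord_recr /= Wp.
have [q [Eq Pq _ Wq]] := PF k (leqnn k).
have X0 : X 0 \in F k.
  have [U C x1 x2 x3] := Hc _ k0; have [p [Ep _ _]] := arc_cons U x1 x2 x3 C.
  by apply/flatten_mapP; exists 0; rewrite ?mem_iota // /A Ep mem_head.
case EF: (F k) Eq X0 => [|x p] //; rewrite rcons_cons Xk => -[Ex Eq] _.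
rewrite {x}Ex in EF.
exists (X 0 :: p); rewrite /= Eq Wq; split=> //.
by rewrite /scycle -EF UF // EF /= Eq Pq.
Qed.

End Arcs.

(** * The forward and the backward cycle of a weak double cycle *)

Section DoubleCycleUnweightable.
Variables (V : finType) (k : nat) (C : 'I_k -> digraph V).
Hypothesis k_ge3 : 2 < k.
Hypothesis C_le2 : forall v, #|[set i : 'I_k | v \in vset (C i)]| <= 2.
Hypothesis C_disj : forall i j : 'I_k, j != ord_pred i -> j != i -> j != ordS i ->
  [disjoint vset (C i) & vset (C j)].
Variables (c : 'I_k -> seq V) (x : 'I_k -> V) (p : 'I_k -> seq V).
Hypothesis c_cycle : forall i, [/\ uniq (c i), 1 < size (c i),
  vset (C i) = [set z in c i] & eset (C i) = [set (z, next (c i) z) | z in c i]].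
Hypothesis p_path : forall i, [/\ uniq (x i :: p i),
  vset (dcap (C i) (C (ordS i))) = [set z in x i :: p i] &
  eset (dcap (C i) (C (ordS i))) = [set f in zip (x i :: p i) (p i)]].

Let k_gt0 : 0 < k. Proof. by apply: leq_trans k_ge3. Qed.

(** Indices are read modulo [k], so that neighbours are [l] and [l.+1] without wrapping. *)
Definition idx l : 'I_k := Ordinal (ltn_pmod l k_gt0).

Lemma idx_per l : idx (l + k) = idx l.
Proof. by apply/val_inj; rewrite /= modnDr. Qed.

Lemma ordS_idx l : ordS (idx l) = idx l.+1.
Proof. by apply/val_inj; rewrite /= -addn1 modnDml addn1. Qed.

Lemma idx_inj i j : idx i = idx j -> i <= j -> j < i + k -> i = j.
Proof. by move/(congr1 val)=> /=; apply: eqmod_small. Qed.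

Definition cyc_idx l := c (idx l).
Definition start l := x (idx l).
Local Notation cc := cyc_idx.
Local Notation Y := start.

Lemma cyc_idx_uniq l : uniq (cc l). Proof. by case: (c_cycle (idx l)). Qed.

Lemma mem_cyc_idx l v : (v \in vset (C (idx l))) = (v \in cc l).
Proof. by have [_ _ -> _] := c_cycle (idx l); rewrite inE. Qed.

Lemma mem_meet l v :
  (v \in x (idx l) :: p (idx l)) = (v \in cc l) && (v \in cc l.+1).
Proof.
have [_ /setP/(_ v) E _] := p_path (idx l).
by rewrite -!mem_cyc_idx -ordS_idx -in_setI; move: E => /= ->; rewrite in_set.
Qed.

Lemma start_mem l : Y l \in cc l /\ Y l \in cc l.+1.
Proof. by apply/andP; rewrite -mem_meet mem_head. Qed.

Lemma no_three l v : v \in cc l -> v \in cc l.+1 -> v \in cc l.+2 -> False.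
Proof.
rewrite -!mem_cyc_idx => v0 v1 v2; have := C_le2 v; rewrite leqNgt => /negP[].
apply/card_gt2P; exists (idx l), (idx l.+1), (idx l.+2); rewrite !inE v0 v1 v2.
split=> //; split; apply/eqP => E.
- by have := idx_inj E; lia.
- by have := idx_inj E; lia.
- by have := idx_inj (esym E); lia.
Qed.

Lemma start_neq l : Y l != Y l.+1.
Proof.
have [a1 a2] := start_mem l; have [b1 b2] := start_mem l.+1.
by apply/eqP=> E; apply: (@no_three l (Y l)) => //; rewrite E.
Qed.

(** The cycle numbered [l.+1] contains both [Y l] and [Y l.+1], which cut it into the forward arc
    [arcA l] and the backward arc [arcB l]. *)
Definition arcA l := arc (cc l.+1) (Y l) (Y l.+1).
Definition arcB l := arc (cc l.+1) (Y l.+1) (Y l).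

Lemma arcAB l v : v \in arcA l -> v \in arcB l -> False.
Proof.
have [_ a2] := start_mem l; have [b1 _] := start_mem l.+1.
exact: arc_disjoint (cyc_idx_uniq _) a2 b1 (start_neq l).
Qed.

Lemma meet_edges l f : f \in zip (x (idx l) :: p (idx l)) (p (idx l)) ->
  f.2 = next (cc l) f.1 /\ f.2 = next (cc l.+1) f.1.
Proof.
have [_ _ /setP/(_ f)] := p_path (idx l); rewrite ordS_idx [in X in _ = X]in_set => /= <-.
have [_ _ _ ->] := c_cycle (idx l); have [_ _ _ ->] := c_cycle (idx l.+1).
by rewrite in_setI => /andP[/imsetP[y _ ->] /imsetP[z _ [-> ->]]].
Qed.

(** The common path starts at [Y l] and cannot reach [Y l.+1], which would then lie on three cycles.
    In [meet_arcB] the path starts at [Y l.+1] and cannot reach [Y l]. *)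
Lemma meet_arcA l v : v \in cc l -> v \in cc l.+1 -> v \in arcA l.
Proof.
move=> v1 v2; have [a1 a2] := start_mem l; have [b1 b2] := start_mem l.+1.
have vP : v \in x (idx l) :: p (idx l) by rewrite mem_meet v1.
apply: (path_in_arc (cyc_idx_uniq l.+1) a2 b1 (start_neq l) _ _ _ vP).
- exact: (mem_arc_start (cyc_idx_uniq _) a2 b1 (start_neq l)).
- by move=> f /meet_edges[].
apply/negP => H; have : Y l.+1 \in x (idx l) :: p (idx l) by rewrite inE H orbT.
by rewrite mem_meet => /andP[H1 H2]; apply: (no_three H1 H2).
Qed.

Lemma meet_arcB l v : v \in cc l.+1 -> v \in cc l.+2 -> v \in arcB l.
Proof.
move=> v1 v2; have [a1 a2] := start_mem l; have [b1 b2] := start_mem l.+1.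
have ne : Y l.+1 != Y l by rewrite eq_sym start_neq.
have vP : v \in x (idx l.+1) :: p (idx l.+1) by rewrite mem_meet v1.
apply: (path_in_arc (cyc_idx_uniq l.+1) b1 a2 ne _ _ _ vP).
- exact: (mem_arc_start (cyc_idx_uniq _) b1 a2 ne).
- by move=> f /meet_edges[].
apply/negP => H; have : Y l \in x (idx l.+1) :: p (idx l.+1) by rewrite inE H orbT.
by rewrite mem_meet => /andP[H1 H2]; apply: (no_three a1 H1 H2).
Qed.

Lemma cyc_idx_adjacent i j v : i < j -> j < i + k -> v \in cc i -> v \in cc j ->
  j = i.+1 \/ j.+1 = i + k.
Proof.
move=> ij jk vi vj; have [->|nS] := eqVneq j i.+1; first by left.
right; apply/eqP/negP => /negP nP.
have := @C_disj (idx i) (idx j); rewrite ordS_idx => D.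
have : [disjoint vset (C (idx i)) & vset (C (idx j))].
  apply: D.
  - apply: contra_neq nP => /(congr1 (@ordS k)); rewrite ord_predK ordS_idx => E.
    by apply: idx_inj; rewrite ?idx_per //; lia.
  - by apply/eqP => /esym E; have := idx_inj E (ltnW ij) jk; lia.
  - apply: contra_neq nS => /esym E; apply/esym; apply: idx_inj E _ _; lia.
rewrite disjoint_subset => /subsetP/(_ v).
by rewrite !inE !mem_cyc_idx vi vj => /(_ isT).
Qed.

Lemma arcA_cyc l v : v \in arcA l -> v \in cc l.+1.
Proof.
have [_ a2] := start_mem l; have [b1 _] := start_mem l.+1.
exact: (arc_sub (cyc_idx_uniq _) a2 b1 (start_neq l)).
Qed.

Lemma arcB_cyc l v : v \in arcB l -> v \in cc l.+1.
Proof.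
have [_ a2] := start_mem l; have [b1 _] := start_mem l.+1.
by apply: (arc_sub (cyc_idx_uniq _) b1 a2); rewrite eq_sym start_neq.
Qed.

Lemma start_per l : Y (l + k) = Y l.
Proof. by rewrite /start idx_per. Qed.

Lemma cyc_idx_per l : cc (l + k) = cc l.
Proof. by rewrite /cyc_idx idx_per. Qed.

(** By [meet_arcB] a forward arc misses the next cycle, and only neighbouring cycles meet. Backward
    arcs likewise miss the previous cycle, by [meet_arcA]. *)
Lemma arcA_disjoint i j v : i < j -> j < k -> v \in arcA i -> v \in arcA j -> False.
Proof.
move=> ij jk vi vj; have ci := arcA_cyc vi; have cj := arcA_cyc vj.
have [| |E|E] := cyc_idx_adjacent (_ : i.+1 < j.+1) _ ci cj => //; first by lia.
  by move: cj; rewrite E => cj; apply: (arcAB vi); apply: meet_arcB.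
apply: (arcAB vj); apply: meet_arcB => //.
by rewrite E cyc_idx_per.
Qed.

Lemma arcB_disjoint i j v : i < j -> j < k -> v \in arcB i -> v \in arcB j -> False.
Proof.
move=> ij jk vi vj; have ci := arcB_cyc vi; have cj := arcB_cyc vj.
have [| |E|E] := cyc_idx_adjacent (_ : i.+1 < j.+1) _ ci cj => //; first by lia.
  by apply: (arcAB _ vj); apply: meet_arcA => //; case: E => ->.
have Ej : j.+1 = i + k by lia.
have : v \in arcA (i + k).
  by apply: meet_arcA; [rewrite -Ej | rewrite -addSn cyc_idx_per].
by rewrite /arcA -!addSn !start_per cyc_idx_per => /arcAB; apply.
Qed.

Variables (G : digraph V) (M : zmodType) (w : V * V -> M).
Hypothesis C_sub : forall i, eset (C i) \subset eset G.

Lemma cyc_idx_scycle l : scycle (edge G) (cc l).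
Proof.
have [U S _ E] := c_cycle (idx l); rewrite /scycle U -size_eq0 -lt0n (ltnW S) /=.
apply: cycle_from_next => // v vc; apply: (subsetP (C_sub (idx l))).
by rewrite E; apply/imsetP; exists v.
Qed.

(** The forward and the backward cycle together have the weight of all [k] cycles. With values in
    any abelian group this is an equality of multiples; for common weight 1 in a field of
    characteristic 0 it says [k = 2]. *)
Lemma double_cycle_weight :
  (forall b, scycle (edge G) b -> cyclen w b = cyclen w (cc 0)) ->
  (cyclen w (cc 0) *+ k = cyclen w (cc 0) *+ 2)%R.
Proof.
move=> Hw.
have Y_k : Y k = Y 0 by rewrite -[k]add0n start_per.
have [|bA [sA EA]] := @scycle_of_arcs _ (edge G) _ w _ (fun l => cc l.+1) Y
  k_gt0 Y_k _ arcA_disjoint.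
  move=> i _; have [_ a2] := start_mem i; have [b1 _] := start_mem i.+1.
  split=> //; [exact: cyc_idx_uniq | | exact: start_neq].
  by case/and3P: (cyc_idx_scycle i.+1).
have Hk i : i < k -> k - i = (k - i.+1).+1 by lia.
have Y_k' : Y (k - k) = Y (k - 0) by rewrite subnn subn0.
(* The backward arcs are joined in order of decreasing index, hence the reversal [k - l]. *)
have [||bB [sB EB]] := @scycle_of_arcs _ (edge G) _ w _ (fun l => cc (k - l))
  (fun l => Y (k - l)) k_gt0 Y_k'.
- move=> i ik; rewrite (Hk _ ik); have [_ a2] := start_mem (k - i.+1).
  have [b1 _] := start_mem (k - i.+1).+1.
  split=> //; [exact: cyc_idx_uniq | by case/and3P: (cyc_idx_scycle (k - i.+1).+1) |].
  by rewrite eq_sym start_neq.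
- move=> i j z ij jk; rewrite (Hk _ jk) (Hk i) ?(ltn_trans ij) // => zi zj.
  by apply: (arcB_disjoint _ _ zj zi); lia.
have -> : (cyclen w (cc 0) *+ 2 = cyclen w bA + cyclen w bB)%R.
  by rewrite mulr2n (Hw bA) ?(Hw bB).
rewrite EA EB.
have -> : (\sum_(i < k) arclen w (cc (k - i)) (Y (k - i)) (Y (k - i.+1)) =
   \sum_(i < k) arclen w (cc i.+1) (Y i.+1) (Y i))%R.
  rewrite (reindex_inj rev_ord_inj) /=; apply: eq_bigr => i _.
  have ik := ltn_ord i.
  have -> : k - (k - i.+1) = i.+1 by lia.
  by have -> : k - (k - i.+1).+1 = i by lia.
rewrite -big_split /=; transitivity (\sum_(i < k) cyclen w (cc 0))%R.
  by rewrite sumr_const card_ord.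
apply: eq_bigr => i _; have [_ a2] := start_mem i; have [b1 _] := start_mem i.+1.
rewrite arclen_add ?start_neq ?cyc_idx_uniq //.
by rewrite (Hw _ (cyc_idx_scycle _)).
Qed.

End DoubleCycleUnweightable.

Lemma double_cycle_not_weightable (R : realType) (V : finType) (G H : digraph V) k :
  subdigraph H G -> 3 <= k -> weak_double_cycle k H -> ~ weightable R G.
Proof.
move=> [_ HG] k3 [C [C_cyc [_ HE] C_le2 C_path C_disj]] [w Hw].
have [c Hc] := choice C_cyc.
have /choice[xp Hxp] i : exists q : V * seq V, [/\ uniq (q.1 :: q.2),
  vset (dcap (C i) (C (ordS i))) = [set z in q.1 :: q.2] &
  eset (dcap (C i) (C (ordS i))) = [set f in zip (q.1 :: q.2) q.2]].
  by have [x [p Hp]] := C_path i; exists (x, p).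
have C_sub i : eset (C i) \subset eset G.
  by apply: subset_trans HG; rewrite HE; apply: bigcup_sup.
have w1 b : scycle (edge G) b -> cyclen w b = 1%R.
  move=> sb; rewrite -(cycle_digraph_sum w sb); apply: Hw.
    exact: cycle_digraph_sub.
  exact: cycle_digraph_dcycle.

have s0 := cyc_idx_scycle k3 Hc C_sub 0.
have := double_cycle_weight (k_ge3 := k3) C_le2 C_disj Hc Hxp (w := w) C_sub.
rewrite (w1 _ s0) => /(_ w1) /eqP; rewrite eqr_nat => /eqP E.
by have := k3; rewrite E.
Qed.

Theorem mainTheorem7 (R : realType) (V : finType) (G : digraph V) :
  weightable R G <->
  ~ (exists (H : digraph V) (k : nat),
       [/\ subdigraph H G, 3 <= k & weak_double_cycle k H]).
Proof.
split=> [wG [H [k [HG k3 HC]]]|no]; first exact: double_cycle_not_weightable HG k3 HC wG.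
(* The integral weight giving 1 to every cycle is carried into [R]. *)
have [w w1] := unit_weight no; exists (fun f => (w f)%:~R)%R => C [_ CG] C_cyc.
have [c [U S _ E]] := C_cyc.
have sc : scycle (edge G) c.
  rewrite /scycle U -size_eq0 -lt0n (ltnW S) /=.
  apply: cycle_from_next => // v vc; apply: (subsetP CG).
  by rewrite E; apply/imsetP; exists v.
rewrite E -(cycle_digraph_eset sc) -rmorph_sum /=.
by rewrite (cycle_digraph_sum w sc) w1.
Qed.
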